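(* Let $\mathcal F_3$ and $\mathcal F_9$ be alternative sets of OPFs on $\mathbb C^3$ and $\mathbb C^9=\mathbb C^3\otimes\mathbb C^3$, with a bilinear product $\star:\mathcal F_3\times\mathcal F_3\to\mathcal F_9$, satisfying the consistency constraints C1, C2, C3 and the Finiteness Principle. Then local tomography is violated: if $\{F_a\}_a$ is a basis of the real span of $\mathcal F_3$, then $\{F_a\star F_b\}_{a,b}$ is not a basis of the real span of $\mathcal F_9$.
   Context: Pure states of $\mathbb C^d$ are rays (unit vectors up to phase); reversible transformations are $\psi\mapsto U\psi$, $U\in\mathrm{SU}(d)$; pure states of the composite of $\mathbb C^{d_{\sf A}}$ and $\mathbb C^{d_{\sf B}}$ are rays of $\mathbb C^{d_{\sf A}}\otimes\mathbb C^{d_{\sf B}}$. An OPF on $\mathbb C^d$ is a function $F$ from rays to $[0,1]$; $\mathcal F_d$ is a set of OPFs containing the unit OPF ${\bf u}\equiv 1$. Constraints: (C1) for every $F\in\mathcal F_d$, $U\in\mathrm{SU}(d)$ there is $F'\in\mathcal F_d$ with $F'(\psi)=F(U\psi)$ for all $\psi$; (C2) distinct rays are separated by some $F\in\mathcal F_d$; (C3) ${\bf u}\star{\bf u}={\bf u}$ and $(F_{\sf A}\star F_{\sf B})(\psi_{\sf A}\otimes\phi_{\sf B})=F_{\sf A}(\psi_{\sf A})F_{\sf B}(\phi_{\sf B})$. Finiteness Principle: the real vector space spanned by $\mathcal F_d$ (as real-valued functions on rays) is finite-dimensional. A set $\mathcal F_d$ is alternative if it contains an OPF not of the Born form $F(\psi)=\mathrm{tr}(\hat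 F|\psi\rangle\langle\psi|)$ with $\hat F$ Hermitian (i.e. it is neither quantum nor a restriction of quantum). *)

(* Defs.v *)
(* real numbers = Stdlib R (a rcfType via Rstruct),
   complex numbers = R[i] from mathcomp-real-closed. *)
From mathcomp Require Import all_boot all_order all_algebra.
From mathcomp Require Import Rstruct.
From mathcomp Require Export complex mxtens.
Set Implicit Arguments. Unset Strict Implicit. Unset Printing Implicit Defensive.
Import Order.TTheory GRing.Theory Num.Theory.
Local Open Scope ring_scope.

Notation Re := Rdefinitions.R.
Notation Cx := (Rdefinitions.R[i]).

(* unit vectors of C^d *)
Definition unitvec (d : nat) (v : 'cV[Cx]_d) : bool :=
  \sum_(i < d) `|v i 0| ^+ 2 == 1.
Definition uvec (d : nat) := {v : 'cV[Cx]_d | unitvec v}.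

(* two unit vectors represent the same ray iff they differ by a phase *)
Definition same_ray d (v w : uvec d) : Prop :=
  exists c : Cx, `|c| = 1 /\ val w = c *: val v.

(* real-valued functions on unit vectors; an OPF is such a function that
   is constant on rays (i.e. a function on rays) with values in [0,1] *)
Definition fn (d : nat) := uvec d -> Re.

Definition is_OPF d (F : fn d) : Prop :=
  (forall v w, same_ray v w -> F v = F w) /\ (forall v, 0 <= F v <= 1).

Definition unitOPF d : fn d := fun _ => 1.

(* conjugate transpose *)
Definition adj d1 d2 (A : 'M[Cx]_(d1, d2)) : 'M[Cx]_(d2, d1) :=
  (map_mx (fun z : Cx => z^*) A)^T.

Definition SU d (U : 'M[Cx]_d) : Prop := U *m adj U = 1%:M /\ \det U = 1.

(* real span of a set of functions *)
Definition in_span d (S : fn d -> Prop) (f : fn d) : Prop :=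
  exists n (c : 'I_n -> Re) (g : 'I_n -> fn d),
    (forall i, S (g i)) /\ f = (fun x => \sum_(i < n) c i * g i x).

(* Finiteness principle: the real span is finite dimensional *)
Definition finite_span d (S : fn d -> Prop) : Prop :=
  exists n (g : 'I_n -> fn d), forall f, S f -> in_span (fun h => exists i, h = g i) f.

(* a set of OPFs on C^d satisfying: unit OPF, C1, C2, Finiteness Principle *)
Definition OPF_set d (S : fn d -> Prop) : Prop :=
  [/\ forall F, S F -> is_OPF F,
      S (@unitOPF d),
      (* C1 *)
      (forall F U, S F -> SU U ->
         exists F', S F' /\ forall v w : uvec d, val w = U *m val v -> F' v = F w),
      (* C2 *)
      (forall v w : uvec d, ~ same_ray v w -> exists F, S F /\ F v <> F w)
    & finite_span S].

(* Born form: F(psi) = tr(Fhat |psi><psi|) with Fhat Hermitian *)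
Definition born d (F : fn d) : Prop :=
  exists Fhat : 'M[Cx]_d, adj Fhat = Fhat /\
    forall v, ((F v)%:C)%C = \tr (Fhat *m (val v *m adj (val v))).

Definition alternative d (S : fn d -> Prop) : Prop :=
  exists F, S F /\ ~ born F.

(* a (finite) family is a basis of the real span of S *)
Definition lin_indep d (I : finType) (b : I -> fn d) : Prop :=
  forall c : I -> Re, (forall x, \sum_i c i * b i x = 0) -> forall i, c i = 0.

Definition basis_of_span d (S : fn d -> Prop) (I : finType) (b : I -> fn d) : Prop :=
  [/\ forall i, in_span S (b i),
      lin_indep b
    & forall f, in_span S f -> exists c : I -> Re, f = (fun x => \sum_i c i * b i x)].

(* the product star : F_3 x F_3 -> F_9, bilinear (on the real span of F_3),
   satisfying C3 *)
Definition product_ok (S3 : fn 3 -> Prop) (S9 : fn 9 -> Prop)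
    (star : fn 3 -> fn 3 -> fn 9) : Prop :=
  [/\ forall F G, S3 F -> S3 G -> S9 (star F G),
      (forall a f g h, in_span S3 f -> in_span S3 g -> in_span S3 h ->
         star (fun x => a * f x + g x) h = (fun y => a * star f h y + star g h y)),
      (forall a f g h, in_span S3 f -> in_span S3 g -> in_span S3 h ->
         star h (fun x => a * f x + g x) = (fun y => a * star h f y + star h g y)),
      star (@unitOPF 3) (@unitOPF 3) = @unitOPF 9
    & forall F G, S3 F -> S3 G -> forall (v w : uvec 3) (x : uvec 9),
         val x = val v *t val w -> star F G x = F v * G w].

(* Main.v *)
(* Write W for the complexified span of the OPFs on C^9, as functions on unit
   vectors; it is finite-dimensional, bounded and U(9)-invariant. Van der
   Waerden's argument gives continuity, so W splits into integral weights under
   every circle of complex reflections z + (t - 1) <e, z> e. Let J be the largest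
   weight that occurs.

   If J <= 1, every function of W restricts to a Hermitian form on every plane,
   so by Jordan and von Neumann it is a Hermitian form, and all OPFs are of the
   Born form. If J >= 2, restricting to circles a + t b identifies an extremal
   function as (<p, z> conj <q, z>)^J with p, q orthonormal. Invariance and
   polarization then put into W the function
     z11^(J-2) (z11 z22 - z12 z21) conj(z33)^J,
   which vanishes on product states without being 0. Local tomography says that
   no such function exists. *)
Require Import Defs.
From mathcomp Require Import all_boot all_order all_algebra.
From mathcomp Require Import Rstruct complex mxtens.
From mathcomp Require Import boolp ring lra zify.
Set Implicit Arguments. Unset Strict Implicit. Unset Printing Implicit Defensive.
Import Order.TTheory GRing.Theory Num.Theory.
Local Open Scope ring_scope.

(** * Hermitian geometry and complex reflections *)

(** The functions come with no regularity, and the field is an abstract [numClosedFieldType], so the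
    argument is algebraic. Compactness enters only as [pigeonhole]. Averages over the circle become
    finite sums over dyadic roots of unity, and continuity then reaches the whole circle. Polynomial
    identities on the circle and Vandermonde interpolation replace derivatives. When [a] is
    orthogonal to [b], a reflection along [b] moves [a + b] along the circle [a + t *: b]. A bound
    on the weights therefore makes every function a Laurent polynomial of bounded degree on such
    circles. For an extremal weight this bound is so tight that a coprimality argument leaves a
    single power. The case [J >= 2] is where two linear factors can be polarized apart to form a
    minor. Three dimensions per factor leave a basis vector of the product orthogonal to the four
    that the minor involves; it carries the conjugated factor. *)

Section Hermitian.
Variables (C : numClosedFieldType) (d : nat).
Implicit Types (a b e z w : 'cV[C]_d) (c s t : C).

Definition dot a b : C := \sum_i (a i 0)^* * b i 0.

Definition unit z := dot z z = 1.

Lemma dotC a b : dot b a = (dot a b)^*.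
Proof.
rewrite /dot rmorph_sum; apply: eq_bigr => i _.
by rewrite rmorphM /= conjCK mulrC.
Qed.

Lemma dotDr a b z : dot a (b + z) = dot a b + dot a z.
Proof. by rewrite -big_split; apply: eq_bigr => i _; rewrite mxE mulrDr. Qed.

Lemma dotZr a c b : dot a (c *: b) = c * dot a b.
Proof.
by rewrite mulr_sumr; apply: eq_bigr => i _; rewrite mxE mulrCA.
Qed.

Lemma dotDl a b z : dot (a + b) z = dot a z + dot b z.
Proof. by rewrite dotC dotDr rmorphD /= -!dotC. Qed.

Lemma dotZl a c b : dot (c *: a) b = c^* * dot a b.
Proof. by rewrite dotC dotZr rmorphM /= -dotC. Qed.

Lemma dotNr a b : dot a (- b) = - dot a b.
Proof. by rewrite -scaleN1r dotZr mulN1r. Qed.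

Lemma dotNl a b : dot (- a) b = - dot a b.
Proof. by rewrite dotC dotNr rmorphN /= -dotC. Qed.

Lemma dotBr a b z : dot a (b - z) = dot a b - dot a z.
Proof. by rewrite dotDr dotNr. Qed.

Lemma dotBl a b z : dot (a - b) z = dot a z - dot b z.
Proof. by rewrite dotDl dotNl. Qed.

Lemma dot0r a : dot a 0 = 0.
Proof. by rewrite -(scale0r 0) dotZr mul0r. Qed.

Lemma dot0l a : dot 0 a = 0.
Proof. by rewrite dotC dot0r rmorph0. Qed.

Lemma dot_ge0 a : 0 <= dot a a.
Proof. by apply: sumr_ge0 => i _; rewrite mulrC -normCK exprn_ge0. Qed.

Lemma dot_eq0 a : dot a a = 0 -> a = 0.
Proof.
move=> h; apply/matrixP => i j; rewrite (ord1 j) mxE.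
have : (a i 0)^* * a i 0 = 0.
  apply: (psumr_eq0P (P := xpredT) (F := fun i => (a i 0)^* * a i 0)) => //.
  by move=> k _; rewrite mulrC -normCK exprn_ge0.
by move/eqP; rewrite mulrC -normCK expf_eq0 /= normr_eq0 => /eqP.
Qed.

Lemma conj_dot_eq0 a b : dot a b = 0 -> dot b a = 0.
Proof. by move=> h; rewrite dotC h rmorph0. Qed.

Lemma unit_norm1 c : `|c| = 1 -> c * c^* = 1.
Proof. by rewrite -normCK => ->; rewrite expr1n. Qed.

Lemma norm1_neq0 c : `|c| = 1 -> c != 0.
Proof. by move=> h; rewrite -normr_eq0 h oner_eq0. Qed.

Lemma norm1_conj c : `|c| = 1 -> `|c^*| = 1.
Proof. by rewrite norm_conjC. Qed.

Lemma norm1M c s : `|c| = 1 -> `|s| = 1 -> `|c * s| = 1.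
Proof. by rewrite normrM => -> ->; rewrite mulr1. Qed.

Lemma unitZ c z : `|c| = 1 -> unit z -> unit (c *: z).
Proof. by rewrite /unit dotZr dotZl => hc ->; rewrite mulr1 unit_norm1. Qed.

Lemma unit_plane u v (x y : C) : unit u -> unit v -> dot u v = 0 ->
  unit (x *: u + y *: v) <-> `|x| ^+ 2 + `|y| ^+ 2 = 1.
Proof.
rewrite /unit => hu hv uv.
rewrite !dotDr !dotDl !dotZr !dotZl hu hv uv (conj_dot_eq0 uv) !normCK.
by rewrite !mulr0 !mulr1 addr0 add0r.
Qed.

Lemma ex_unit_dir z : z != 0 ->
  exists n e, [/\ 0 < n, n * n = dot z z, unit e & z = n *: e].
Proof.
move=> z0; have dz : 0 < dot z z.
  by rewrite lt_def dot_ge0 andbT; apply: contraNneq z0 => /dot_eq0 ->.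
have n0 : 0 < sqrtC (dot z z) by rewrite sqrtC_gt0.
exists (sqrtC (dot z z)), ((sqrtC (dot z z))^-1 *: z).
have hn : sqrtC (dot z z) * sqrtC (dot z z) = dot z z by rewrite -expr2 sqrtCK.
split=> //; last by rewrite scalerA divff ?scale1r // gt_eqF.
rewrite /unit dotZr dotZl -{3}hn conj_Creal ?realV ?ger0_real ?ltW //.
by field; rewrite gt_eqF.
Qed.

Definition rfl e t z := z + ((t - 1) * dot e z) *: e.

Lemma rfl_lin e t c z w : rfl e t (c *: z + w) = c *: rfl e t z + rfl e t w.
Proof.
rewrite /rfl dotDr dotZr; apply/matrixP => i j; rewrite !mxE; ring.
Qed.

Lemma dot_rfl e t z w : unit e -> `|t| = 1 -> dot (rfl e t z) (rfl e t w) = dot z w.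
Proof.
rewrite /unit /rfl => he /unit_norm1 ht.
rewrite !dotDr !dotDl !dotZr !dotZl he !rmorphM /= rmorphB /= rmorph1 -dotC.
set x := dot e w; set y := dot z e.
suff -> : dot z w + (t^* - 1) * y * x + ((t - 1) * x * y + (t - 1) * x * ((t^* - 1) * y * 1))
  = dot z w + (t * t^* - 1) * (x * y) by rewrite ht subrr mul0r addr0.
ring.
Qed.

Lemma rfl_unit e t z : unit e -> `|t| = 1 -> unit z -> unit (rfl e t z).
Proof. by move=> he ht; rewrite /unit dot_rfl. Qed.

Lemma rflM e s t z : unit e -> rfl e s (rfl e t z) = rfl e (s * t) z.
Proof.
rewrite /unit /rfl => he; rewrite dotDr dotZr he; apply/matrixP => i j; rewrite !mxE; ring.
Qed.

Lemma rfl1 e z : rfl e 1 z = z.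
Proof. by rewrite /rfl subrr mul0r scale0r addr0. Qed.

Lemma rflC e e' s t z : dot e e' = 0 -> rfl e s (rfl e' t z) = rfl e' t (rfl e s z).
Proof.
move=> h; rewrite /rfl !dotDr !dotZr h (conj_dot_eq0 h) !mulr0 !addr0.
by rewrite -!addrA [X in _ + X]addrC.
Qed.

Lemma rfl_ortho e t z : dot e z = 0 -> rfl e t z = z.
Proof. by rewrite /rfl => ->; rewrite mulr0 scale0r addr0. Qed.

Lemma rfl_self e t : unit e -> rfl e t e = t *: e.
Proof.
rewrite /rfl => ->; apply/matrixP => i j; rewrite !mxE; ring.
Qed.

(* The direction of the complex reflection carrying [z] to [w] is [w - z]; its
   multiplier [t] is then forced. *)
Lemma rfl_carry z w t : unit z -> unit w -> z != w ->
  (t - 1) * (dot w z - 1) = 2 - dot z w - dot w z ->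
  exists e, [/\ unit e, rfl e t z = w
    & forall x, dot z x = 0 -> dot w x = 0 -> rfl e t x = x].
Proof.
move=> hz hw zw ht.
have : w - z != 0 by rewrite subr_eq0 eq_sym.
case/ex_unit_dir=> n [e [n0 hn he hwz]]; exists e.
have nc : n^* = n by rewrite conj_Creal // gtr0_real.
have ewz : e = n^-1 *: (w - z) by rewrite hwz scalerA mulVf ?scale1r // gt_eqF.
split=> // [|x zx wx]; last first.
  by apply: rfl_ortho; rewrite ewz dotZl dotBl zx wx subr0 mulr0.
have h1 : (t - 1) * dot e z = n.
  have : n * (t - 1) * dot e z = n * n.
    rewrite hn dotBr !dotBl hz hw -[RHS]/(_) -mulrA mulrCA.
    have -> : n * dot e z = dot w z - 1.
      by rewrite -{1}nc -dotZl -hwz dotBl hz.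
    rewrite ht; ring.
  by rewrite -mulrA => /mulfI -> //; rewrite gt_eqF.
by rewrite /rfl h1 -hwz addrC subrK.
Qed.

End Hermitian.

(** * Invariant spaces of functions on the unit sphere *)

Section Admissible.
Variables (C : numClosedFieldType) (d : nat).
Implicit Types (a b e z w : 'cV[C]_d) (c s t : C) (F G : 'cV[C]_d -> C).

(** By [admX] only the values on unit vectors matter. [admF] packs finite dimension and boundedness
    into one reproducing formula: finitely many values determine [F], through bounded coefficient
    functions. *)
Record admissible (W : ('cV[C]_d -> C) -> Prop) : Prop := Admissible {
  adm0 : W (fun=> 0);
  admL : forall c F G, W F -> W G -> W (fun z => c * F z + G z);
  admX : forall F G, (forall z, unit z -> F z = G z) -> W F -> W G;
  admU : forall e t F, unit e -> `|t| = 1 -> W F -> W (F \o rfl e t);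
  admP : forall c F z, W F -> `|c| = 1 -> unit z -> F (c *: z) = F z;
  admC : forall F, W F -> W (fun z => (F z)^*);
  admF : exists N (x : 'I_N -> 'cV[C]_d) (f : 'I_N -> 'cV[C]_d -> C) (M : C),
    [/\ 0 <= M, forall i, unit (x i), forall i, W (f i),
        forall i z, unit z -> `|f i z| <= M
      & forall F, W F -> forall z, unit z -> F z = \sum_i F (x i) * f i z] }.

(** Compactness of bounded sets in finite dimension; it also yields the Archimedean property, see
    [exp2_small]. Proved for [Cx] in [pigeonhole_complex]. *)
Definition pigeonhole := forall (K : finType) (v : nat -> K -> C) (M : C),
  (forall n k, `|v n k| <= M) -> forall eps : C, 0 < eps ->
  exists n m, (n < m)%N /\ forall k, `|v n k - v m k| <= eps.

Section Symmetry.
Variables (W : ('cV[C]_d -> C) -> Prop) (admW : admissible W).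

(** The properties of products of reflections that suffice to transport weights and values from one
    axis to another. *)
Definition symmetry (g : 'cV[C]_d -> 'cV[C]_d) :=
  [/\ forall c z w, g (c *: z + w) = c *: g z + g w,
      forall z w, dot (g z) (g w) = dot z w,
      forall z, exists y, g y = z
    & forall F, W F -> W (F \o g)].

Lemma symmetry_id : symmetry id.
Proof. by split=> // z; exists z. Qed.

Lemma symmetry_rfl e t : unit e -> `|t| = 1 -> symmetry (rfl e t).
Proof.
move=> he ht; split.
- exact: rfl_lin.
- by move=> z w; apply: dot_rfl.
- by move=> z; exists (rfl e t^* z); rewrite rflM // unit_norm1 // rfl1.
- by move=> F; apply: (admU admW).
Qed.

Lemma symmetry_comp g h : symmetry g -> symmetry h -> symmetry (g \o h).
Proof.
move=> [g1 g2 g3 g4] [h1 h2 h3 h4]; split=> /=.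
- by move=> c z w; rewrite h1 g1.
- by move=> z w; rewrite g2 h2.
- by move=> z; have [y <-] := g3 z; have [x <-] := h3 y; exists x.
- by move=> F /g4 /h4.
Qed.

Lemma symmetry_carry z w : unit z -> unit w ->
  exists g, [/\ symmetry g, g z = w
    & forall x, dot z x = 0 -> dot w x = 0 -> g x = x].
Proof.
move=> hz hw; have [<-|zw] := eqVneq z w.
  by exists id; split=> //; exact: symmetry_id.
set s := dot z w.
have hs : dot w z = s^* by rewrite dotC.
have s1 : 1 - s != 0.
  apply: contra_neq zw => h; apply/esym/eqP; rewrite -subr_eq0; apply/eqP/dot_eq0.
  rewrite dotBr !dotBl hz hw hs -/s.
  have -> : s = 1 by rewrite -[1](subrK s) h add0r.
  by rewrite rmorph1 !subrr.
have s1' : 1 - s^* != 0 by rewrite -(rmorph1 (@Num.conj C)) -rmorphB fmorph_eq0.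
(* This multiplier is forced by the hypothesis of [rfl_carry]; its numerator and denominator are
   conjugate up to sign, so it has modulus 1. *)
have := @rfl_carry C d z w (- ((1 - s) / (1 - s^*))) hz hw zw.
rewrite hs -/s; case=> [|e [he ew fx]]; first by field.
exists (rfl e (- ((1 - s) / (1 - s^*)))); split=> //.
apply: symmetry_rfl => //; rewrite normrN normf_div.
have -> : 1 - s^* = (1 - s)^* by rewrite rmorphB rmorph1.
by rewrite norm_conjC divff // normr_eq0.
Qed.

Lemma symmetry_unit g z : symmetry g -> unit z -> unit (g z).
Proof. by case=> _ h _ _; rewrite /unit h. Qed.

Lemma symmetryZ g c z : symmetry g -> g (c *: z) = c *: g z.
Proof.
case=> h _ _ _; have g0 : g 0 = 0.
  by have := h (-1) 0 0; rewrite scaler0 addr0 scaleN1r addNr.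
by rewrite -[c *: z]addr0 h g0 addr0.
Qed.

Lemma symmetryD g z w : symmetry g -> g (z + w) = g z + g w.
Proof. by case=> h _ _ _; have := h 1 z w; rewrite !scale1r. Qed.

Lemma symmetry_rflE g e t z : symmetry g -> g (rfl e t z) = rfl (g e) t (g z).
Proof.
move=> sg; rewrite /rfl (symmetryD _ _ sg) (symmetryZ _ _ sg).
by case: sg => _ -> _ _.
Qed.

Lemma admZ c F : W F -> W (fun z => c * F z).
Proof.
move=> WF; have := admL admW c WF (adm0 admW).
by apply: (admX admW) => z _; rewrite addr0.
Qed.

Lemma admB F G : W F -> W G -> W (fun z => F z - G z).
Proof.
move=> WF WG; have := admL admW (-1) WG WF.
by apply: (admX admW) => z _; rewrite mulN1r addrC.
Qed.

Lemma adm_sum (I : finType) (c : I -> C) (f : I -> 'cV[C]_d -> C) :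
  (forall i, W (f i)) -> W (fun z => \sum_i c i * f i z).
Proof.
move=> Wf; suff H (r : seq I) : W (fun z => \sum_(i <- r) c i * f i z) by exact: H.
elim: r => [|i r IH].
  by have := adm0 admW; apply: (admX admW) => z _; rewrite big_nil.
by have := admL admW (c i) (Wf i) IH; apply: (admX admW) => z _; rewrite big_cons.
Qed.

End Symmetry.

(** The Cayley transform of the natural numbers: infinitely many distinct points of the unit circle
    in any such field. *)
Definition circ_pt (n : nat) : C := (n%:R + 'i) / (n%:R - 'i).

Lemma circ_den_neq0 n : n%:R - 'i != 0 :> C.
Proof.
apply/eqP => /(congr1 (fun x => x * (n%:R + 'i))).
have -> : (n%:R - 'i) * (n%:R + 'i) = n%:R ^+ 2 + 1 :> C.
  by rewrite -subr_sqr sqrCi opprK.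
by rewrite mul0r -natrX natr1 => /eqP; rewrite pnatr_eq0.
Qed.

Lemma norm_circ_pt n : `|circ_pt n| = 1.
Proof.
rewrite /circ_pt normf_div.
have -> : n%:R - 'i = (n%:R + 'i)^* :> C by rewrite rmorphD /= conjCi conjC_nat.
by rewrite norm_conjC divff // -norm_conjC normr_eq0 rmorphD /= conjCi conjC_nat circ_den_neq0.
Qed.

Lemma circ_pt_inj : injective circ_pt.
Proof.
move=> n m; rewrite /circ_pt => /eqP; rewrite eqr_div ?circ_den_neq0 // => /eqP h.
have : 'i * (2 * (n%:R - m%:R)) = 0 :> C.
  transitivity ((m%:R + 'i) * (n%:R - 'i) - (n%:R + 'i) * (m%:R - 'i) : C).
    ring.
  by rewrite h subrr.
move/eqP; rewrite !mulf_eq0 (negPf (neq0Ci _)) pnatr_eq0 /= subr_eq0 eqr_nat.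
by move/eqP.
Qed.

Lemma poly_circle_eq0 (p : {poly C}) :
  (forall n, p.[circ_pt n] = 0) -> p = 0.
Proof.
move=> h; apply/eqP/negP => /negP p0.
have := max_poly_roots p0 (rs := [seq circ_pt i | i <- iota 0 (size p)]).
rewrite map_inj_uniq ?iota_uniq; last exact: circ_pt_inj.
rewrite size_map size_iota ltnn => H; apply: notF; apply: H => //.
by apply/allP => _ /mapP[i _ ->]; rewrite /root h.
Qed.

Lemma poly_circle_eq (p q : {poly C}) :
  (forall t, `|t| = 1 -> p.[t] = q.[t]) -> p = q.
Proof.
move=> h; apply/eqP; rewrite -subr_eq0; apply/eqP/poly_circle_eq0 => n.
by rewrite hornerD hornerN h ?subrr // norm_circ_pt.
Qed.

Lemma bessel e z : unit e -> unit z -> `|dot e z| ^+ 2 <= 1.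
Proof.
move=> he hz; rewrite -subr_ge0.
have -> : 1 - `|dot e z| ^+ 2 = dot (z - dot e z *: e) (z - dot e z *: e).
  rewrite dotBr !dotBl !dotZr !dotZl he hz normCK [dot z e]dotC; ring.
exact: dot_ge0.
Qed.

(* All rays close enough to that of [z] are reached from [z] by reflections of
   one and the same multiplier [tau]. *)
Lemma rfl_reach tau t e z : `|tau| = 1 -> `|t| = 1 -> tau != 1 ->
  `|t - 1| <= `|tau - 1| -> unit e -> unit z ->
  exists2 c, `|c| = 1 & c *: rfl e t z = z \/
    exists2 e', unit e' & rfl e' tau z = c *: rfl e t z.
Proof.
move=> htau ht tau1 tle he hz.
set x := `|dot e z| ^+ 2; have x1 : x <= 1 by exact: bessel.
have x0 : 0 <= x by rewrite exprn_ge0.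
have xr : x^* = x by rewrite conj_Creal // ger0_real.
have nt u : `|u| = 1 -> `|u - 1| ^+ 2 = 2 - u - u^*.
  move=> hu; rewrite normCK rmorphB /= rmorph1.
  transitivity (u * u^* + 1 - u - u^*); first ring.
  by rewrite unit_norm1.
have T0 : 0 < `|tau - 1| ^+ 2 by rewrite exprn_gt0 // normr_gt0 subr_eq0.
set r := `|t - 1| ^+ 2 / `|tau - 1| ^+ 2.
have r0 : 0 <= r by rewrite divr_ge0 // exprn_ge0.
have r1 : r <= 1 by rewrite ler_pdivrMr // mul1r lerXn2r // nnegrE.
set q := x * (1 - x) * r.
have q1 : 0 <= 1 - 4 * q.
  have xx0 : 0 <= 4 * (x * (1 - x)) by rewrite !mulr_ge0 // subr_ge0.
  have h : 4 * q <= 4 * (x * (1 - x)).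
    by rewrite /q mulrA ler_piMr.
  apply: (@le_trans _ _ (1 - 4 * (x * (1 - x)))); last by rewrite lerD2l lerN2.
  have -> : 1 - 4 * (x * (1 - x)) = (1 - 2 * x) ^+ 2 by ring.
  by rewrite real_exprn_even_ge0 // realB // realM ?realn // ger0_real.
(* A reflection of multiplier [tau] along [e'] gives the inner product [1 + (tau - 1) * y], where
   [y] is the squared modulus of [dot e' z]. Its squared modulus is [1 - y * (1 - y) * |tau - 1|^2],
   so matching that of [s] means solving [y * (1 - y) = q]; [r <= 1] makes the discriminant
   nonnegative. *)
set y := (1 - sqrtC (1 - 4 * q)) / 2.
have yr : y^* = y.
  rewrite conj_Creal // realM ?realV ?realn // realB ?real1 //.
  by rewrite ger0_real // sqrtC_ge0.
have yq : y * (1 - y) = q.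
  transitivity ((1 - sqrtC (1 - 4 * q) ^+ 2) / 4); first by rewrite /y; field.
  by rewrite sqrtCK; field.
set w := rfl e t z; have hw : unit w by exact: rfl_unit.
set s := dot z w; set S := 1 + (tau - 1) * y.
have sE : s = 1 + (t - 1) * x.
  rewrite /s /w /rfl dotDr dotZr hz [dot z e]dotC /x normCK; ring.
have sS : s * s^* = S * S^*.
  have nrm u v : `|u| = 1 -> v^* = v ->
      (1 + (u - 1) * v) * (1 + (u - 1) * v)^* = 1 - v * (1 - v) * `|u - 1| ^+ 2.
    move=> hu hv; rewrite nt // rmorphD rmorphM /= rmorphB /= rmorph1 hv.
    transitivity (1 - v * (1 - v) * (2 - u - u^*) + v ^+ 2 * (u * u^* - 1)); first ring.
    by rewrite unit_norm1 // subrr mulr0 addr0.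
  rewrite sE /S !nrm // yq /q /r; congr (1 - _).
  by field; rewrite normr_eq0 subr_eq0.
have [c hc cs] : exists2 c, `|c| = 1 & c * s = S.
  have nsS : `|s| = `|S|.
    by apply/eqP; rewrite -(@eqrXn2 _ 2) // !normCK sS.
  have [s0|s0] := eqVneq s 0.
    exists 1; first by rewrite normr1.
    by move: nsS; rewrite s0 mulr0 normr0 => /esym/eqP; rewrite normr_eq0 => /eqP.
  exists (S / s); last by rewrite divfK.
  by rewrite normf_div nsS divff // normr_eq0 -normr_eq0 -nsS normr_eq0.
exists c => //; have [|zw] := eqVneq z (c *: w); first by left.
right; have hcw : unit (c *: w) by exact: unitZ.
have E1 : dot z (c *: w) = S by rewrite dotZr cs.
have E2 : dot (c *: w) z = S^* by rewrite dotC E1.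
have [|e' [he' e'w _]] := @rfl_carry C d z (c *: w) tau hz hcw zw; last by exists e'.
rewrite E1 E2 /S rmorphD rmorphM /= rmorphB /= rmorph1 yr.
transitivity (y * (tau * tau^* + 1 - tau - tau^*)); first ring.
rewrite unit_norm1 //; ring.
Qed.

End Admissible.

(** * Automatic continuity *)

Section Continuity.
Variables (C : numClosedFieldType) (d : nat) (W : ('cV[C]_d -> C) -> Prop).
Hypotheses (pg : pigeonhole C) (admW : admissible W).
Implicit Types (a b e z w : 'cV[C]_d) (c s t : C) (F G : 'cV[C]_d -> C).

(* Van der Waerden's argument: by the pigeonhole principle some reflection of
   multiplier [tau != 1] moves no function of [W] by much, hence neither does
   any conjugate of it, and these conjugates sweep out a neighbourhood. *)
Lemma equicontinuous : exists N (x : 'I_N -> 'cV[C]_d),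
  [/\ forall i, unit (x i),
      forall F, W F -> (forall i, F (x i) = 0) -> forall z, unit z -> F z = 0
    & forall eps : C, 0 < eps -> exists2 delta : C, 0 < delta &
      forall F t e z, W F -> `|t| = 1 -> `|t - 1| <= delta -> unit e -> unit z ->
      `|F (rfl e t z) - F z| <= eps * \sum_i `|F (x i)|].
Proof.
have [N [x [f [M [M0 ux Wf fM fE]]]]] := admF admW.
exists N, x; split=> // [F WF F0 z uz|eps eps0].
  by rewrite (fE F WF z uz) big1 // => i _; rewrite F0 mul0r.
have [[e0 ue0]|noU] := pselect (exists e0 : 'cV[C]_d, unit e0); last first.
  by exists 1 => // F t e z _ _ _ ue; case: noU; exists e.
have NM0 : 0 <= N%:R * M by rewrite mulr_ge0.
(* A factor [N * M] is lost twice: in [H1], expanding a difference of reflected functions, and in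
   [H3], bounding the values of [F \o g] at the sample points. *)
pose eta := eps / ((N%:R * M) ^+ 2 + 1).
have den0 : 0 < (N%:R * M) ^+ 2 + 1 by rewrite ltr_wpDl // exprn_ge0.
have eta0 : 0 < eta by rewrite divr_gt0.
have [n [m [nm hnm]]] := pg (K := ('I_N * 'I_N)%type)
  (v := fun n k => f k.1 (rfl e0 (circ_pt C n) (x k.2)))
  (fun n k => fM _ _ (rfl_unit ue0 (norm_circ_pt C n) (ux k.2))) eta0.
set s := circ_pt C n in hnm; set s' := circ_pt C m in hnm.
have hs : `|s| = 1 by exact: norm_circ_pt.
have hs' : `|s'| = 1 by exact: norm_circ_pt.
(* The reflections by [s] and [s'] act almost equally on every [f i], so their quotient moves every
   [f i] little. *)
pose tau := s * s'^*.
have ss' : s'^* * s' = 1 by rewrite mulrC unit_norm1.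
have htau : `|tau| = 1 by rewrite norm1M ?norm1_conj.
have tau1 : tau != 1.
  apply: contraTneq nm => h; suff /circ_pt_inj -> : circ_pt C n = circ_pt C m by rewrite ltnn.
  by rewrite -/s -/s' -[s]mulr1 -ss' mulrA -/tau h mul1r.
have le1 (b : 'I_N -> C) B : (forall i, `|b i| <= B) -> \sum_i `|b i| <= N%:R * B.
  move=> h; apply: (le_trans (ler_sum _ (fun i _ => h i))).
  by rewrite sumr_const card_ord mulr_natl.
have H1 i z : unit z -> `|f i (rfl e0 tau z) - f i z| <= N%:R * M * eta.
  move=> uz; pose y := rfl e0 s'^* z.
  have uy : unit y by exact: rfl_unit (norm1_conj hs') uz.
  have -> : rfl e0 tau z = rfl e0 s y by rewrite rflM.
  have {1}-> : z = rfl e0 s' y by rewrite rflM // mulrC ss' rfl1.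
  pose G := fun z => f i (rfl e0 s z) - f i (rfl e0 s' z).
  have WG : W G by apply: admB => //; apply: (admU admW).
  rewrite -[_ - _]/(G y) (fE G WG y uy) -mulrA.
  apply: (le_trans (ler_norm_sum _ _ _)); apply: le1 => j.
  by rewrite normrM (mulrC M); apply: ler_pM => //; [exact: (hnm (i, j)) | exact: fM].
have H2 F z : W F -> unit z ->
    `|F (rfl e0 tau z) - F z| <= (N%:R * M * eta) * \sum_i `|F (x i)|.
  move=> WF uz; rewrite !(fE F WF) //; last exact: rfl_unit.
  rewrite -sumrB mulr_sumr; apply: (le_trans (ler_norm_sum _ _ _)).
  apply: ler_sum => i _; rewrite -mulrBr normrM mulrC ler_wpM2r //; exact: H1.
have H3 F e z : W F -> unit e -> unit z ->
    `|F (rfl e tau z) - F z| <= eps * \sum_i `|F (x i)|.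
  move=> WF ue uz; have [g [sg ge _]] := symmetry_carry admW ue0 ue.
  have [_ _ gs gW] := sg; have [y gy] := gs z.
  have uy : unit y by case: sg => _ h _ _; rewrite /unit -h gy.
  rewrite -gy -ge -(symmetry_rflE _ _ _ sg).
  have := H2 _ y (gW _ WF) uy; move/le_trans; apply.
  set nu := \sum_i `|F (x i)|; have nu0 : 0 <= nu by apply: sumr_ge0.
  have hnu : \sum_i `|F (g (x i))| <= N%:R * (M * nu).
    apply: le1 => i; rewrite (fE F WF); last exact: (symmetry_unit sg (ux i)).
    apply: (le_trans (ler_norm_sum _ _ _)); rewrite mulr_sumr; apply: ler_sum => j _.
    by rewrite normrM (mulrC M) ler_wpM2l //; apply: fM; exact: (symmetry_unit sg (ux i)).
  apply: (@le_trans _ _ (N%:R * M * eta * (N%:R * (M * nu)))).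
    by rewrite ler_wpM2l // mulr_ge0 // ltW.
  have -> : N%:R * M * eta * (N%:R * (M * nu)) =
    eps * nu * ((N%:R * M) ^+ 2 / ((N%:R * M) ^+ 2 + 1)).
    by rewrite /eta; field; rewrite gt_eqF.
  rewrite ler_piMr ?mulr_ge0 ?(ltW eps0) // ler_pdivrMr // mul1r.
  by rewrite lerDl.
exists `|tau - 1|; first by rewrite normr_gt0 subr_eq0.
move=> F t e z WF ht tle ue uz.
have uw : unit (rfl e t z) by exact: rfl_unit.
have [c hc] := rfl_reach htau ht tau1 tle ue uz.
rewrite -(admP admW WF hc uw) => -[->|[e' ue' <-]]; last exact: H3.
by rewrite subrr normr0 mulr_ge0 ?(ltW eps0) ?sumr_ge0.
Qed.

Lemma rfl_continuous F : W F -> forall eps : C, 0 < eps -> exists2 delta : C, 0 < delta &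
  forall t e z, `|t| = 1 -> `|t - 1| <= delta -> unit e -> unit z ->
  `|F (rfl e t z) - F z| <= eps.
Proof.
move=> WF eps eps0; have [N [x [_ _ h]]] := equicontinuous.
set nu := \sum_i `|F (x i)|; have nu0 : 0 <= nu by apply: sumr_ge0.
have nu1 : 0 < nu + 1 by rewrite ltr_wpDl.
have [delta d0 hd] := h (eps / (nu + 1)) (divr_gt0 eps0 nu1).
exists delta => // t e z ht td ue uz; apply: (le_trans (hd F t e z WF ht td ue uz)).
rewrite -/nu mulrAC ler_pdivrMr // ler_wpM2l ?(ltW eps0) //.
by rewrite lerDl.
Qed.

(** With [eps = 1 / (N + 1)], adding up the bounds at the [N] sample points gives
    [nu <= N / (N + 1) * nu], hence [nu = 0]. So reflections near the identity have no eigenvalue at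
    distance 1 or more from 1. *)
Lemma eigen_near1 : exists2 delta : C, 0 < delta &
  forall F t e c, W F -> `|t| = 1 -> `|t - 1| <= delta -> unit e ->
    (forall z, unit z -> F (rfl e t z) = c * F z) -> 1 <= `|c - 1| ->
    forall z, unit z -> F z = 0.
Proof.
have [N [x [ux x0 h]]] := equicontinuous.
have N1 : 0 < N.+1%:R :> C by rewrite ltr0n.
have [delta d0 hd] := h (N.+1%:R^-1) (eq_ind_r _ N1 (invr_gt0 _)).
exists delta => // F t e c WF ht td ue Fc c1; apply: x0 => // i.
set nu := \sum_i `|F (x i)| in hd *.
have nu0 : 0 <= nu by apply: sumr_ge0.
have : nu <= N%:R / N.+1%:R * nu.
  rewrite {1}/nu -mulrA.
  have -> : N%:R * (N.+1%:R^-1 * nu) = \sum_(i < N) N.+1%:R^-1 * nu :> C.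
    by rewrite sumr_const card_ord mulr_natl.
  apply: ler_sum => j _; have := hd F t e (x j) WF ht td ue (ux j).
  rewrite Fc // -{2}[F (x j)]mul1r -mulrBl normrM; apply: le_trans.
  by rewrite ler_peMl.
rewrite -subr_ge0 -{2}[nu]mul1r -mulrBl.
have -> : N%:R / N.+1%:R - 1 = - N.+1%:R^-1 :> C.
  by rewrite -natr1; field; rewrite natr1 gt_eqF.
rewrite mulNr oppr_ge0 pmulr_rle0 ?invr_gt0 // => nu1.
have : nu = 0 by apply/eqP; rewrite eq_le nu0 nu1.
move/eqP; rewrite psumr_eq0 // => /allP /(_ i (mem_index_enum _)).
by rewrite normr_eq0 => /eqP.
Qed.

(** Some [2^-n] and [2^-m] with [n < m] are [eps]-close, and they differ by at least [2^-(n+1)]. *)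
Lemma exp2_small (eps : C) : 0 < eps -> exists l, (2 ^+ l)^-1 <= eps.
Proof.
move=> eps0.
have [|n [m [nm]]] := pg (K := 'I_1) (v := fun n _ => (2 ^+ n)^-1 : C) (M := 1) _ eps0.
  move=> n _; rewrite ger0_norm ?invr_ge0 ?exprn_ge0 //.
  by rewrite invf_le1 ?exprn_gt0 // exprn_ege1 // ler1n.
move=> /(_ ord0) h; exists n.+1; apply: le_trans h.
have hm : (2 ^+ m)^-1 <= (2 ^+ n.+1)^-1 :> C.
  by rewrite lef_pV2 ?posrE ?exprn_gt0 // ler_weXn2l // ler1n.
have E : (2 ^+ n)^-1 = (2 ^+ n.+1)^-1 + (2 ^+ n.+1)^-1 :> C.
  by rewrite exprS; field; rewrite expf_neq0 // pnatr_eq0.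
apply: (@le_trans _ _ ((2 ^+ n)^-1 - (2 ^+ m)^-1)).
  by rewrite E -addrA lerDl subr_ge0.
apply: real_ler_norm; rewrite realB // ger0_real // invr_ge0 exprn_ge0 //.
Qed.

End Continuity.

(** * Dyadic roots of unity *)

Section DyadicRoots.
Variable C : numClosedFieldType.
Implicit Types (s t u : C).

Lemma norm1_exp u n : `|u| = 1 -> `|u ^+ n| = 1.
Proof. by rewrite normrX => ->; rewrite expr1n. Qed.

Lemma norm1_sub1 u : `|u| = 1 -> `|u - 1| ^+ 2 = 2 - (u + u^*).
Proof.
move=> hu; rewrite normCK rmorphB /= rmorph1.
transitivity (u * u^* + 1 - (u + u^*)); first ring.
by rewrite unit_norm1.
Qed.

Lemma norm1_add1 u : `|u| = 1 -> `|u + 1| ^+ 2 = 2 + (u + u^*).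
Proof.
move=> hu; rewrite normCK rmorphD /= rmorph1.
transitivity (u * u^* + 1 + (u + u^*)); first ring.
by rewrite unit_norm1.
Qed.

Lemma norm_expB1 u n : `|u| = 1 -> `|u ^+ n - 1| <= n%:R * `|u - 1|.
Proof.
move=> hu; elim: n => [|n IH]; first by rewrite subrr normr0 mul0r.
have -> : u ^+ n.+1 - 1 = u * (u ^+ n - 1) + (u - 1) by rewrite exprS; ring.
rewrite (le_trans (ler_normD _ _)) // normrM hu mul1r -natr1 mulrDl mul1r.
by rewrite lerD2r.
Qed.

(** The root of unity [exp (2 pi i / 2^(l+2))], by bisection of angles: [s + 1] points along the
    bisector of [s] and 1. *)
Fixpoint om l : C := if l is l'.+1 then (om l' + 1) / `|om l' + 1| else 'i.

(* Twice the real and imaginary parts are [u + u^*] and ['i * (u^* - u)]. *)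
Lemma om_base l :
  [/\ `|om l| = 1, 0 <= om l + (om l)^* & 0 <= 'i * ((om l)^* - om l)].
Proof.
elim: l => [|l [n1 re im]] /=.
  split; first exact: normCi.
    by rewrite conjCi subrr.
  rewrite conjCi; have -> : 'i * (- 'i - 'i) = - 2 * 'i ^+ 2 :> C by ring.
  by rewrite sqrCi; have -> : -2 * -1 = 2 :> C by ring.
set s := om l in n1 re im *; set n := `|s + 1|.
have n2 : n ^+ 2 = 2 + (s + s^*) by rewrite norm1_add1.
have n0 : 0 < n.
  have h : 0 < n ^+ 2 by rewrite n2 ltr_pwDl.
  by rewrite lt_def normr_ge0 andbT; apply: contraTneq h => ->; rewrite expr0n ltxx.
have nr : n^* = n by rewrite conj_Creal // gtr0_real.
have E : ((s + 1) / n)^* = (s^* + 1) / n.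
  by rewrite rmorphM rmorphD /= rmorph1 fmorphV /= nr.
split.
- by rewrite normf_div normr_id -/n divff // gt_eqF.
- rewrite E -mulrDl; have -> : s + 1 + (s^* + 1) = n ^+ 2 by rewrite n2; ring.
  by rewrite divr_ge0 ?exprn_ge0 // ltW.
- rewrite E -mulrBl mulrA divr_ge0 ?(ltW n0) //.
  by have -> : s^* + 1 - (s + 1) = s^* - s by ring.
Qed.

Lemma norm_om l : `|om l| = 1. Proof. by case: (om_base l). Qed.

Lemma norm_omD1 l : 2 <= `|om l + 1| ^+ 2.
Proof. by case: (om_base l) => n1 re _; rewrite norm1_add1 // lerDl. Qed.

Lemma norm_omD1_gt0 l : 0 < `|om l + 1|.
Proof.
rewrite lt_def normr_ge0 andbT; apply: contraTneq (norm_omD1 l) => ->.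
by rewrite expr0n /= lt_geF.
Qed.

Lemma omS_sqr l : om l.+1 ^+ 2 = om l.
Proof.
rewrite /= expr_div_n normCK rmorphD /= rmorph1.
have h : om l * (om l)^* = 1 by rewrite unit_norm1 // norm_om.
have h1 : om l + 1 != 0 by rewrite -normr_eq0 gt_eqF // norm_omD1_gt0.
have h2 : (om l)^* + 1 != 0.
  by rewrite -(rmorph1 (@Num.conj C)) -rmorphD fmorph_eq0.
apply: (mulIf (mulf_neq0 h1 h2)); rewrite divfK ?mulf_neq0 //.
transitivity ((om l * (om l)^* + om l) * (om l + 1)); last ring.
rewrite h; ring.
Qed.

Lemma omS_re l : om l.+1 + (om l.+1)^* = `|om l + 1|.
Proof.
have n0 := norm_omD1_gt0 l; have n1 := norm_om l.
have n2 : `|om l + 1| ^+ 2 = 2 + (om l + (om l)^*) by rewrite norm1_add1.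
have -> : (om l.+1)^* = ((om l)^* + 1) / `|om l + 1|.
  by rewrite /= rmorphM rmorphD /= rmorph1 fmorphV /= conj_normC.
rewrite /= -mulrDl; apply: (mulIf (lt0r_neq0 n0)); rewrite divfK ?gt_eqF //.
rewrite -expr2 n2; ring.
Qed.

Lemma om_expn l m : om (l + m) ^+ (2 ^ m) = om l.
Proof.
elim: m => [|m IH]; first by rewrite addn0 expr1.
by rewrite addnS expnS exprM omS_sqr.
Qed.

Lemma om_half l : om l ^+ (2 ^ l.+1) = -1.
Proof. by rewrite expnS mulnC exprM -{1}[l]add0n om_expn sqrCi. Qed.

Lemma om_prim l : (2 ^ l.+2).-primitive_root (om l).
Proof.
have h : om l ^+ (2 ^ l.+2) = 1 by rewrite expnS mulnC exprM om_half sqrrN expr1n.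
have [m pm mdv] := prim_order_exists (expn_gt0 2 l.+2) h.
have /dvdn_pfactor H : prime 2 by [].
move: mdv => /H[k kl mE].
suff kE : k = l.+2 by rewrite -kE -mE.
apply/eqP; rewrite eqn_leq kl /= leqNgt; apply/negP => kl1.
have : om l ^+ (2 ^ l.+1) = 1.
  apply/eqP; rewrite -(prim_order_dvd pm) mE; exact: dvdn_exp2l.
rewrite om_half => /eqP; rewrite eq_sym -subr_eq0 opprK.
by rewrite -(natrD _ 1 1) pnatr_eq0.
Qed.

(** The angle is at most a right angle. For odd exponents, the product formula for cosines leads to
    the two neighbouring even exponents, hence to the previous level. *)
Lemma om_pow_re l n : (n <= 2 ^ l)%N -> 0 <= om l ^+ n + (om l ^+ n)^*.
Proof.
elim: l n => [|l IH] n.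
  case: n => [|[|n]] // _.
    by rewrite expr0 rmorph1 addr_ge0.
  by rewrite expr1 /= conjCi subrr.
move=> hn; have := odd_double_half n; case: (odd n) => E; last first.
  rewrite -E add0n -muln2 mulnC exprM omS_sqr; apply: IH.
  by move: hn; rewrite -{1}E expnS; lia.
set k := n./2 in E; have {}E : k.*2.+1 = n by [].
have kl : (k < 2 ^ l)%N by move: hn; rewrite -{1}E expnS; lia.
have n0 := norm_omD1_gt0 l.
rewrite -(pmulr_rge0 _ n0) -omS_re.
have ww := unit_norm1 (norm_om l.+1).
move: (omS_sqr l) ww; move: (om l.+1) => w w2 ww.
have -> : (w + w^*) * (w ^+ n + (w ^+ n)^*) =
   (w ^+ k.+1.*2 + (w ^+ k.+1.*2)^*) + (w ^+ k.*2 + (w ^+ k.*2)^*).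
  rewrite -E doubleS !exprS !rmorphM /=.
  transitivity (w * (w * w ^+ k.*2) + w^* * (w^* * (w ^+ k.*2)^*)
     + (w * w^*) * w ^+ k.*2 + (w * w^*) * (w ^+ k.*2)^*); first ring.
  rewrite ww; ring.
rewrite -!muln2 ![(_ * 2)%N]mulnC !exprM w2.
by rewrite addr_ge0 // IH // ltnW.
Qed.

(** Each bisection at least halves the squared distance to 1: [n = |om l + 1| <= 2] gives
    [2 - n <= (4 - n^2) / 2]. *)
Lemma om_near1 l : `|om l - 1| ^+ 2 <= 2 * (2 ^+ l)^-1.
Proof.
elim: l => [|l IH].
  rewrite norm1_sub1 ?norm_om //= conjCi subrr subr0 expr0 invr1 mulr1 //.
apply: (@le_trans _ _ (`|om l - 1| ^+ 2 / 2)); last first.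
  have -> : 2 * (2 ^+ l.+1)^-1 = 2 * (2 ^+ l)^-1 / 2 :> C by rewrite exprS invfM; ring.
  by rewrite ler_pM2r ?invr_gt0.
rewrite !norm1_sub1 ?norm_om // omS_re; set n := `|_ + 1|.
have n2 : n ^+ 2 = 2 + (om l + (om l)^*) by rewrite norm1_add1 // norm_om.
have n0 : 0 < n by exact: norm_omD1_gt0.
have -> : om l + (om l)^* = n ^+ 2 - 2 by rewrite n2; ring.
rewrite -subr_ge0.
have -> : (2 - (n ^+ 2 - 2)) / 2 - (2 - n) = (2 - n) * n / 2 by field.
rewrite mulr_ge0 ?invr_ge0 // mulr_ge0 // ?(ltW n0) // subr_ge0.
by rewrite (le_trans (ler_normD _ _)) // norm_om normr1.
Qed.

(** For angles [theta] of [u] and [alpha] of [w], both in the upper half plane, the hypotheses mean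
    [alpha <= pi / 2] and [theta <= 2 alpha], and the conclusion means [|theta - alpha| <= alpha].
    Inside, [X], [Y], [p], [q] are doubled cosines and sines. *)
Lemma circle_halve u w : `|u| = 1 -> `|w| = 1 ->
  0 <= w + w^* -> 0 <= 'i * (w^* - w) -> w ^+ 2 + (w ^+ 2)^* <= u + u^* ->
  0 <= 'i * (u^* - u) -> w + w^* <= u * w^* + (u * w^*)^*.
Proof.
move=> hu hw re im h imu.
have uu := unit_norm1 hu; have ww := unit_norm1 hw.
pose X := u + u^*; pose Y := 'i * (u^* - u); pose p := w + w^*; pose q := 'i * (w^* - w).
have ii : 'i * 'i = -1 :> C by rewrite -expr2 sqrCi.
have XY : Y ^+ 2 = 4 - X ^+ 2.
  transitivity (('i * 'i) * (u^* - u) ^+ 2); first by rewrite /Y; ring.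
  transitivity (4 * (u * u^*) - X ^+ 2); last by rewrite uu mulr1.
  rewrite ii /X; ring.
have pq : q ^+ 2 = 4 - p ^+ 2.
  transitivity (('i * 'i) * (w^* - w) ^+ 2); first by rewrite /q; ring.
  transitivity (4 * (w * w^*) - p ^+ 2); last by rewrite ww mulr1.
  rewrite ii /p; ring.
have h' : p ^+ 2 - 2 <= X.
  apply: le_trans h; rewrite le_eqVlt; apply/orP; left; apply/eqP.
  rewrite rmorphXn /=; transitivity (w ^+ 2 + w^* ^+ 2 + 2 * (w * w^*) - 2).
    by rewrite /p; ring.
  rewrite ww; ring.
have X2 : 0 <= 2 - X by rewrite -norm1_sub1 // exprn_ge0.
have key : p * (2 - X) <= Y * q.
  have h1 : 0 <= p * (2 - X) by rewrite mulr_ge0.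
  have h2 : 0 <= Y * q by rewrite mulr_ge0.
  rewrite -(@ler_pXn2r _ 2) ?nnegrE // [(Y * q) ^+ 2]exprMn XY pq -subr_ge0.
  have -> : (4 - X ^+ 2) * (4 - p ^+ 2) - (p * (2 - X)) ^+ 2
    = 4 * ((2 - X) * (X - (p ^+ 2 - 2))) by ring.
  by rewrite !mulr_ge0 // subr_ge0.
rewrite -subr_ge0 rmorphM /= conjCK.
have -> : u * w^* + u^* * w - (w + w^*) = (Y * q - p * (2 - X)) / 2.
  transitivity ((('i * 'i) * (u^* - u) * (w^* - w) - p * (2 - X)) / 2).
    by rewrite ii /X /p; field.
  by rewrite /Y /q; field.
by apply: divr_ge0 => //; rewrite subr_ge0.
Qed.

(** If [u] is within the angle of [om l] of 1, then [u / w] or [u * w], with [w = om l.+1], is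
    within the angle of [w]; the sign of the imaginary part of [u] decides which. *)
Lemma om_dense l t : `|t| = 1 ->
  exists m, `|t * (om l)^* ^+ m - 1| <= `|om l - 1|.
Proof.
move=> ht.
suff [m hm] : exists m, om l + (om l)^* <= t * (om l)^* ^+ m + (t * (om l)^* ^+ m)^*.
  exists m; rewrite -(@ler_pXn2r _ 2) ?nnegrE //.
  rewrite !norm1_sub1 ?norm_om // ?lerD2l ?lerN2 //.
  by rewrite norm1M // norm1_exp // norm1_conj // norm_om.
elim: l => [|l [m hm]].
  have : t + t^* \is Num.real by rewrite CrealE rmorphD /= conjCK addrC.
  rewrite /= conjCi subrr => /orP[h|h]; first by exists 0%N; rewrite expr0 mulr1.
  exists 2%N; rewrite sqrrN sqrCi mulrN1 rmorphN /= -opprD oppr_ge0 //.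
set u := t * (om l)^* ^+ m in hm.
have hu : `|u| = 1 by rewrite norm1M // norm1_exp // norm1_conj // norm_om.
have P : (om l.+1)^* ^+ (2 ^ l.+3) = 1.
  by rewrite -rmorphXn /= (prim_expr_order (om_prim l.+1)) rmorph1.
move: (om_base l.+1) (omS_sqr l) P; move: (om l.+1) => w [hw re im] w2 P.
have ww := unit_norm1 hw.
have uE : u = t * w^* ^+ m.*2 by rewrite -muln2 mulnC exprM -rmorphXn /= w2.
have : 'i * (u^* - u) \is Num.real.
  by rewrite CrealE rmorphM rmorphB /= conjCi conjCK mulNr -mulrN opprB.
rewrite -w2 in hm.
case/orP => imu.
  exists m.*2.+1; rewrite exprSr mulrA -uE; exact: circle_halve.
(* As [w] has order [2 ^ l.+3], the exponent [(2 ^ l.+3).-1] stands for -1. *)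
exists (m.*2 + (2 ^ l.+3).-1)%N.
have -> : t * w^* ^+ (m.*2 + (2 ^ l.+3).-1) = u * w.
  rewrite exprD mulrA -uE; congr (_ * _).
  apply: (mulIf (norm1_neq0 (norm1_conj hw))); rewrite -exprSr prednK ?expn_gt0 //.
  by rewrite P ww.
have hu' := norm1_conj hu.
have := @circle_halve u^* w hu' hw re im.
rewrite conjCK [u^* + u]addrC => /(_ hm).
have -> : 'i * (u - u^*) = - ('i * (u^* - u)) by ring.
rewrite oppr_ge0 => /(_ imu) /le_trans; apply.
by rewrite !rmorphM /= !conjCK addrC.
Qed.

Hypothesis pg : pigeonhole C.

Lemma om_small (eps : C) : 0 < eps ->
  exists L, forall l, (L <= l)%N -> `|om l - 1| <= eps.
Proof.
move=> eps0; have e2 : 0 < eps ^+ 2 / 2 by rewrite divr_gt0 // exprn_gt0.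
have [L hL] := exp2_small pg e2; exists L => l Ll.
rewrite -(@ler_pXn2r _ 2) ?nnegrE ?(ltW eps0) // (le_trans (om_near1 l)) //.
rewrite mulrC -ler_pdivlMr //; apply: le_trans hL.
by rewrite lef_pV2 ?posrE ?exprn_gt0 // ler_weXn2l // ler1n.
Qed.

End DyadicRoots.

(** * Weights *)

Section WeightDecomposition.
Variables (C : numClosedFieldType) (d : nat) (W : ('cV[C]_d -> C) -> Prop).
Hypotheses (pg : pigeonhole C) (admW : admissible W).
Implicit Types (a b e z w : 'cV[C]_d) (c s t : C) (F : 'cV[C]_d -> C).

(* [G n] is the component of weight [n - D]; the factor [t ^+ D] avoids negative
   exponents. *)
Definition decomposable D := forall e F, unit e -> W F ->
  exists2 G : nat -> 'cV[C]_d -> C, forall n, W (G n) &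
    forall t z, `|t| = 1 -> unit z ->
    t ^+ D * F (rfl e t z) = \sum_(n < D.*2.+1) t ^+ n * G n z.

(* The defect of the weight equation under a square root [s] of [t] is an
   eigenfunction of eigenvalue [- s ^+ n / s ^+ D]. *)
Lemma weight_sqrt delta D n s e F :
  (forall F t e c, W F -> `|t| = 1 -> `|t - 1| <= delta -> unit e ->
    (forall z, unit z -> F (rfl e t z) = c * F z) -> 1 <= `|c - 1| ->
    forall z, unit z -> F z = 0) ->
  unit e -> W F -> `|s| = 1 -> `|s - 1| <= delta ->
  (forall k, (k <= D)%N -> 0 <= s ^+ k + (s ^+ k)^*) -> (n <= D.*2)%N ->
  (forall z, unit z -> (s ^+ 2) ^+ D * F (rfl e (s ^+ 2) z) = (s ^+ 2) ^+ n * F z) ->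
  forall z, unit z -> s ^+ D * F (rfl e s z) = s ^+ n * F z.
Proof.
move=> near1 ue WF hs sd hre nD hF z uz; apply/eqP; rewrite -subr_eq0; apply/eqP.
pose H := fun z => s ^+ D * F (rfl e s z) - s ^+ n * F z.
have sD0 : s ^+ D != 0 by rewrite expf_neq0 // norm1_neq0.
have WH : W H.
  apply: (admB admW); apply: (admZ admW) => //; exact: (admU admW).
apply: (near1 H s e (- s ^+ n / s ^+ D) WH hs sd ue) z uz => [z uz|].
  have := hF z uz; rewrite /H rflM // -expr2 -!exprM !mul2n -!addnn !exprD => h.
  apply: (mulfI sD0); transitivity (s ^+ D * s ^+ D * F (rfl e (s ^+ 2) z)
    - s ^+ n * (s ^+ D * F (rfl e s z))); first ring.
  by rewrite h; field.
have -> : - s ^+ n / s ^+ D - 1 = - ((s ^+ n + s ^+ D) / s ^+ D) by field.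
rewrite normrN normf_div (norm1_exp D hs) divr1.
(* Taking out the smaller power leaves [s ^+ k + 1] with [k <= D]; since [s ^+ k] has nonnegative
   real part, its squared modulus is at least 2. *)
wlog suff gen : / forall k m, (k <= D)%N -> 1 <= `|s ^+ m * s ^+ k + s ^+ m|.
  case: (leqP n D) => nD'.
    by have := gen (D - n)%N n (leq_subr _ _); rewrite -exprD subnKC // addrC.
  have := gen (n - D)%N D; rewrite -exprD subnKC ?(ltnW nD') //; apply.
  by rewrite leq_subLR addnn.
move=> k m kD; have -> : s ^+ m * s ^+ k + s ^+ m = s ^+ m * (s ^+ k + 1) by ring.
rewrite normrM (norm1_exp m hs) mul1r -(@ler_pXn2r _ 2) ?nnegrE // expr1n.
rewrite norm1_add1 ?norm1_exp // (@le_trans _ _ 2) ?ler1n //.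
by rewrite lerDl hre.
Qed.

Lemma weight_exp D n t e F m : unit e -> `|t| = 1 ->
  (forall z, unit z -> t ^+ D * F (rfl e t z) = t ^+ n * F z) ->
  forall z, unit z -> (t ^+ m) ^+ D * F (rfl e (t ^+ m) z) = (t ^+ m) ^+ n * F z.
Proof.
move=> ue ht h; elim: m => [|m IH] z uz; first by rewrite expr0 !expr1n rfl1.
have h1 := IH _ (rfl_unit ue ht uz); have h2 := h z uz.
rewrite exprSr -rflM // !exprMn -mulrA [t ^+ D * _]mulrC mulrA h1.
by rewrite -mulrA [F _ * _]mulrC h2 mulrA.
Qed.

(** Powers of dyadic roots are dense in the circle, and [F] is uniformly continuous under
    reflections. *)
Lemma weight_closure D n L e F : unit e -> W F ->
  (forall l, (L <= l)%N -> forall z, unit z ->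
     om C l ^+ D * F (rfl e (om C l) z) = om C l ^+ n * F z) ->
  forall t z, `|t| = 1 -> unit z -> t ^+ D * F (rfl e t z) = t ^+ n * F z.
Proof.
move=> ue WF h t z ht uz; apply/eqP; rewrite -subr_eq0 -normr_eq0; apply/eqP.
set E := `|_|; have E0 : 0 <= E by exact: normr_ge0.
suff small : forall eps : C, 0 < eps -> E <= eps.
  apply/eqP; rewrite eq_le E0 andbT.
  have [//|Epos] := boolP (E <= 0).
  have E2 : 0 < E by rewrite lt_def E0 andbT; apply: contraNneq Epos => ->.
  have := small (E / 2) (divr_gt0 E2 _); rewrite ltr0n => /(_ isT).
  by rewrite lt_geF // ltr_pdivrMr // ltr_pMr // ltr1n.
move=> eps eps0; have e2 : 0 < eps / 2 by rewrite divr_gt0.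
have [delta d0 hd] := rfl_continuous pg admW WF e2.
set B := (D + n)%:R * `|F z| + 1; have B0 : 0 < B by rewrite ltr_wpDl // mulr_ge0.
have [L1 hL1] := om_small pg d0.
have [L2 hL2] := om_small pg (divr_gt0 e2 B0).
pose l := (L + L1 + L2)%N.
have [m hm] := om_dense l ht.
set u := t * _ in hm.
have hw : `|om C l ^+ m| = 1 by rewrite norm1_exp // norm_om.
have hu : `|u| = 1 by rewrite norm1M // norm1_exp // norm1_conj // norm_om.
have ud : `|u - 1| <= delta by apply: le_trans hm (hL1 _ _); rewrite /l; lia.
have uB : `|u - 1| <= eps / 2 / B by apply: le_trans hm (hL2 _ _); rewrite /l; lia.
set w := om C l ^+ m in hw.
have tE : t = w * u.
  by rewrite /u /w mulrCA -rmorphXn /= unit_norm1 ?mulr1.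
have hz := rfl_unit ue hu uz.
have Ew := @weight_exp D n (om C l) e F m ue (norm_om C l) (h l _) _ hz.
have EE : E = `|u ^+ D * F (rfl e u z) - u ^+ n * F z|.
  rewrite /E tE -rflM // !exprMn mulrAC Ew; last by rewrite /l; lia.
  rewrite -[RHS]mul1r -(norm1_exp n hw) -normrM -/w; congr `|_|; ring.
have -> : E = `|u ^+ D * (F (rfl e u z) - F z) + ((u ^+ D - 1) * F z - (u ^+ n - 1) * F z)|.
  by rewrite EE; congr `|_|; ring.
rewrite (le_trans (ler_normD _ _)) // normrM norm1_exp // mul1r.
have -> : eps = eps / 2 + eps / 2 by field.
apply: lerD; first exact: hd.
rewrite (le_trans (ler_normB _ _)) // !normrM -mulrDl.
apply: (@le_trans _ _ ((D%:R * `|u - 1| + n%:R * `|u - 1|) * `|F z|)).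
  by rewrite ler_wpM2r // lerD // norm_expB1.
rewrite -mulrDl -natrD mulrAC mulrC.
apply: (@le_trans _ _ (`|u - 1| * B)).
  by rewrite ler_wpM2l // lerDl.
by rewrite -ler_pdivlMr.
Qed.

(** Fourier analysis on the cyclic group generated by [w = om C L] splits [F] into eigenfunctions.
    [weight_sqrt] lifts each eigenvalue equation to all finer dyadic roots, and [weight_closure] to
    the circle. *)
Lemma ex_decomposable : exists D, decomposable D.
Proof.
have [delta d0 near1] := eigen_near1 pg admW.
have [L hL] := om_small pg d0.
pose D := (2 ^ L.+1)%N; exists D => e F ue WF.
have DD : D.*2 = (2 ^ L.+2)%N by rewrite -mul2n -expnS.
set w := om C L; have hw : `|w| = 1 by exact: norm_om.
have ww := unit_norm1 hw.
have pw : (D.*2).-primitive_root w by rewrite DD; exact: om_prim.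
have wD : w ^+ D = -1 by exact: om_half.
have M0 : (D.*2)%:R != 0 :> C by rewrite pnatr_eq0 DD expn_eq0.
(* The sign stands for [w ^+ D = -1] and shifts the index, so that [G n] has weight [n - D]. *)
pose kap n := - (w^* ^+ n).
have kapD n : kap n ^+ D.*2 = 1.
  rewrite /kap exprNn -muln2 mulnC exprM sqrrN expr1n expr1n mul1r -exprM mulnC.
  by rewrite exprM -rmorphXn /= mul2n (prim_expr_order pw) rmorph1 expr1n.
pose G n z := \sum_(m < D.*2) ((D.*2)%:R^-1 * kap n ^+ m) * F (rfl e (w ^+ m) z).
have WG n : W (G n).
  apply: (adm_sum admW) => m; apply: (admU admW) => //; exact: norm1_exp.
have Gw n z : unit z -> w ^+ D * G n (rfl e w z) = w ^+ n * G n z.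
  move=> uz; rewrite wD mulN1r.
  pose b m := ((D.*2)%:R^-1 * kap n ^+ m) * F (rfl e (w ^+ m) z).
  have h : \sum_(m < D.*2) b m.+1 = \sum_(m < D.*2) b m.
    apply/eqP; rewrite -subr_eq0 -sumrB -(big_mkord xpredT (fun m => b m.+1 - b m)).
    by rewrite telescope_sumr // /b kapD (prim_expr_order pw) !expr0 subrr.
  have -> : G n z = \sum_(m < D.*2) b m by rewrite /G /b; apply: eq_bigr.
  rewrite -h -sumrN mulr_sumr; apply: eq_bigr => m _.
  rewrite rflM // -exprSr /b [kap n ^+ m.+1]exprS.
  transitivity (- (w * w^*) ^+ n * ((D.*2)%:R^-1 * kap n ^+ m * F (rfl e (w ^+ m.+1) z))).
    by rewrite ww expr1n mulN1r.
  rewrite {2}/kap exprMn; ring.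
have Gl n l : (n <= D.*2)%N -> (L <= l)%N -> forall z, unit z ->
    om C l ^+ D * G n (rfl e (om C l) z) = om C l ^+ n * G n z.
  move=> nD /subnKC <-; elim: (l - L)%N => [|k IH]; first by rewrite addn0; exact: Gw.
  rewrite addnS.
  have hd : `|om C (L + k).+1 - 1| <= delta by apply: hL; lia.
  apply: (weight_sqrt near1 ue (WG n) (norm_om C _) hd _ nD).
    move=> j jD; apply: om_pow_re; apply: (leq_trans jD).
    by rewrite leq_exp2l // ltnS leq_addr.
  by rewrite omS_sqr.
(* The weights [D] and [-D] coincide on a group of order [2 D], so the top term of the decomposition
   is set to 0. *)
exists (fun n z => (n < D.*2)%:R * G n z) => [n|t z ht uz]; first exact: (admZ admW).
rewrite big_ord_recr /= ltnn mul0r mulr0 addr0.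
have FE : F (rfl e t z) = \sum_(n < D.*2) G n (rfl e t z).
  rewrite /G exchange_big /=.
  have D0 : (0 < D.*2)%N by rewrite DD expn_gt0.
  rewrite (bigD1 (Ordinal D0)) //= [X in _ + X]big1 ?addr0.
    rewrite (eq_bigr (fun=> (D.*2)%:R^-1 * F (rfl e t z))) => [|n _]; last first.
      by rewrite !expr0 mulr1 rfl1.
    by rewrite sumr_const card_ord -[RHS]mulr_natl mulrA divff // mul1r.
  move=> m; rewrite -val_eqE /= => m0.
  rewrite -mulr_suml; suff -> : \sum_(n < D.*2) (D.*2)%:R^-1 * kap n ^+ m = 0 by rewrite mul0r.
  rewrite -mulr_sumr.
  have -> : \sum_(n < D.*2) kap n ^+ m = (-1) ^+ m * \sum_(n < D.*2) (w^* ^+ m) ^+ n.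
    rewrite mulr_sumr; apply: eq_bigr => n _.
    by rewrite /kap [LHS]exprNn -!exprM mulnC.
  have wm : w^* ^+ m != 1.
    rewrite -rmorphXn /= -(rmorph1 (@Num.conj C)) (inj_eq (can_inj (@conjCK C))).
    rewrite -(prim_order_dvd pw); apply/negP => /dvdn_leq; rewrite lt0n m0 => /(_ isT).
    by rewrite leqNgt ltn_ord.
  have := subrX1 (w^* ^+ m) D.*2.
  rewrite -exprM mulnC exprM -rmorphXn /= (prim_expr_order pw) rmorph1 expr1n subrr.
  move/esym/eqP; rewrite mulf_eq0 subr_eq0 (negPf wm) /= => /eqP ->.
  by rewrite !mulr0.
rewrite FE mulr_sumr; apply: eq_bigr => n _; rewrite ltn_ord mul1r.
apply: (weight_closure ue (WG n) (L := L)) => // l Ll; apply: Gl => //.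
by rewrite ltnW.
Qed.

End WeightDecomposition.

(** * Functions of extremal weight on a plane *)

Section LinearFactors.
Variable K : fieldType.
Implicit Types a b c e : K.

Definition lin a b : {poly K} := a *: 'X + b%:P.

Lemma horner_lin a b t : (lin a b).[t] = a * t + b.
Proof. by rewrite hornerD hornerZ hornerX hornerC. Qed.

Lemma size_lin a b : a != 0 -> size (lin a b) = 2.
Proof.
move=> a0; rewrite size_polyDl ?size_scale ?size_polyX //.
by rewrite (leq_ltn_trans (size_polyC_leq1 _)).
Qed.

Lemma coprimep_lin a b c e : a * e - b * c != 0 -> coprimep (lin a b) (lin c e).
Proof.
move=> h; apply/Bezout_eq1_coprimepP.
exists ((- c / (a * e - b * c))%:P, (a / (a * e - b * c))%:P) => /=.
rewrite /lin -!mul_polyC.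
transitivity (((a * e - b * c) / (a * e - b * c))%:P : {poly K}); last by rewrite divff.
rewrite !polyCM !polyCN polyCB !polyCM; ring.
Qed.

(** Coprimality makes [A ^+ n] divide [N], whose degree is at most that of [A ^+ n]. *)
Lemma coprime_power_cofactor (A B N N' : {poly K}) n : coprimep A B -> size A = 3 ->
  (size N <= n.*2.+1)%N -> N' * A ^+ n = N * B ^+ n -> exists k, N = k *: A ^+ n.
Proof.
move=> cAB sA sN h.
have : A ^+ n %| N.
  have : A ^+ n %| N * B ^+ n by rewrite -h dvdp_mull.
  by rewrite Gauss_dvdpl // coprimep_expl // coprimep_expr.
move=> /divpK hN; exists (N %/ A ^+ n)`_0; rewrite -mul_polyC -size1_polyC //.
have A0 : A != 0 by rewrite -size_poly_gt0 sA.
rewrite size_divp ?expf_neq0 // size_exp sA /= mul2n.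
by rewrite leq_subLR addn1.
Qed.

End LinearFactors.

Section ExtremalWeight.
Variables (C : numClosedFieldType) (d : nat) (W : ('cV[C]_d -> C) -> Prop).
Hypotheses (pg : pigeonhole C) (admW : admissible W).
Implicit Types (a b e u v z w : 'cV[C]_d) (c s t x y : C) (F f : 'cV[C]_d -> C).

Definition weight e n F :=
  forall t z, `|t| = 1 -> unit z -> F (rfl e t z) = t ^+ n * F z.

Lemma circle_coef N (a b : nat -> C) :
  (forall t, `|t| = 1 -> \sum_(n < N) t ^+ n * a n = \sum_(n < N) t ^+ n * b n) ->
  forall n, (n < N)%N -> a n = b n.
Proof.
move=> h n nN.
have : \poly_(i < N) a i = \poly_(i < N) b i.
  apply: poly_circle_eq => t ht; rewrite !horner_poly.
  have := h t ht; congr (_ = _); apply: eq_bigr => i _; exact: mulrC.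
by move=> /(congr1 (fun p : {poly C} => p`_n)); rewrite !coef_poly nN.
Qed.

Lemma decomp_coef_weight D e F (G : nat -> 'cV[C]_d -> C) : unit e ->
  (forall t z, `|t| = 1 -> unit z ->
    t ^+ D * F (rfl e t z) = \sum_(n < D.*2.+1) t ^+ n * G n z) ->
  forall n s z, (n < D.*2.+1)%N -> `|s| = 1 -> unit z ->
    s ^+ D * G n (rfl e s z) = s ^+ n * G n z.
Proof.
move=> ue h n s z nD hs uz.
apply: (circle_coef (a := fun n => s ^+ D * G n (rfl e s z))
  (b := fun n => s ^+ n * G n z) _ nD) => t ht.
transitivity (s ^+ D * (t ^+ D * F (rfl e t (rfl e s z)))).
  rewrite h //; last exact: rfl_unit.
  by rewrite mulr_sumr; apply: eq_bigr => i _; rewrite mulrCA.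
rewrite rflM // mulrA -exprMn [s * t]mulrC h //; last exact: norm1M.
by apply: eq_bigr => i _; rewrite exprMn mulrA.
Qed.

Lemma decomposable01 : decomposable W 0 -> decomposable W 1.
Proof.
move=> h e F ue WF; have [G WG hG] := h e F ue WF.
exists (fun n z => (n == 1%N)%:R * G 0%N z) => [n|t z ht uz]; first exact: (admZ admW).
have := hG t z ht uz; rewrite !big_ord_recr !big_ord0 /= !expr0 !mul1r !add0r => ->.
by rewrite !mul0r !mulr0 add0r addr0.
Qed.

(** A nonzero top component serves directly, a nonzero bottom one after conjugation, which reverses
    weights. If both always vanished, trimming them would give a decomposition for [J]. *)
Lemma extremal_weight J : decomposable W J.+1 -> ~ decomposable W J ->
  exists u f z, [/\ unit u, W f, unit z, f z != 0 & weight u J.+1 f].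
Proof.
move=> dJ ndJ; apply: contrapT => none; apply: ndJ => e F ue WF.
have [G WG hG] := dJ e F ue WF.
have zero f : W f -> weight e J.+1 f -> forall z, unit z -> f z = 0.
  move=> Wf wf z uz; apply: contrapT => /eqP fz; apply: none.
  by exists e, f, z.
have wG := decomp_coef_weight ue hG.
have Gtop z : unit z -> G J.+1.*2 z = 0.
  apply: zero => // t y ht uy.
  apply: (mulfI (expf_neq0 J.+1 (norm1_neq0 ht))).
  by rewrite wG // mulrA -exprD addnn.
have Gbot z : unit z -> G 0%N z = 0.
  move=> uz; apply/eqP; rewrite -(fmorph_eq0 (@Num.conj C)) /=; apply/eqP.
  apply: (zero (fun z => (G 0%N z)^*)) => //; first exact: (admC admW).
  move=> t y ht uy; have := wG 0%N t y isT ht uy; rewrite expr0 mul1r => <-.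
  rewrite rmorphM rmorphXn /= mulrA -exprMn unit_norm1 // expr1n mul1r //.
exists (fun n => G n.+1) => [n|t z ht uz]; first exact: WG.
apply: (mulfI (norm1_neq0 ht)); rewrite mulrA -exprS hG // doubleS.
rewrite big_ord_recr /= Gtop // mulr0 addr0 big_ord_recl /= Gbot // mulr0 add0r.
by rewrite mulr_sumr; apply: eq_bigr => i _; rewrite mulrA -exprS.
Qed.

Lemma extremal_dichotomy : (exists J, [/\ (1 < J)%N, decomposable W J &
    exists u f z, [/\ unit u, W f, unit z, f z != 0 & weight u J f]])
  \/ decomposable W 1.
Proof.
have [D] := ex_decomposable pg admW; elim: D => [|D IH] dD.
  by right; apply: decomposable01.
have [/IH //|ndD] := pselect (decomposable W D).
case: D dD ndD {IH} => [|D] dD ndD; first by right.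
by left; exists D.+2; split=> //; apply: extremal_weight.
Qed.

(** If [b] is a multiple of the unit vector [e], then [a + t *: b] is [rfl e t (a + b)], and the
    weight components at [a + b] are the coefficients. *)
Lemma circle_poly D F a b : decomposable W D -> W F -> dot a b = 0 -> unit (a + b) ->
  exists2 p : {poly C}, (size p <= D.*2.+1)%N &
    forall t, `|t| = 1 -> t ^+ D * F (a + t *: b) = p.[t].
Proof.
move=> dD WF ab uab; have [b0|/ex_unit_dir[n [e [n0 _ ue bE]]]] := eqVneq b 0.
  exists (F a *: 'X^D) => [|t _].
    by rewrite (leq_trans (size_scale_leq _ _)) // size_polyXn ltnS -addnn leq_addr.
  by rewrite b0 scaler0 addr0 hornerZ hornerXn mulrC.
have [G _ hG] := dD e F ue WF.
exists (\poly_(i < D.*2.+1) G i (a + b)) => [|t ht]; first exact: size_poly.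
have ea : dot e a = 0.
  move: ab; rewrite bE dotZr => /eqP; rewrite mulf_eq0 gt_eqF //= => /eqP.
  exact: conj_dot_eq0.
have <- : rfl e t (a + b) = a + t *: b.
  by rewrite bE addrC rfl_lin rfl_self // rfl_ortho // !scalerA [n * t]mulrC addrC.
rewrite horner_poly hG //.
by apply: eq_bigr => i _; rewrite mulrC.
Qed.

Lemma ex_circle_pow_neq1 J : (0 < J)%N -> exists2 t : C, `|t| = 1 & t ^+ J != 1.
Proof.
move=> J0; exists (om C J); first exact: norm_om.
rewrite -(prim_order_dvd (om_prim C J)); apply/negP => /(dvdn_leq J0).
by rewrite leqNgt (leq_trans (ltn_expl J (isT : 1 < 2)%N)) // leq_exp2l // ltnW.
Qed.

End ExtremalWeight.

(** * Rigidity of extremal functions on a plane *)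

Section PlaneLemma.
Variables (C : numClosedFieldType) (d : nat) (W : ('cV[C]_d -> C) -> Prop).
Hypothesis admW : admissible W.
Variables (J : nat) (u v : 'cV[C]_d) (f : 'cV[C]_d -> C).
Hypotheses (J0 : (0 < J)%N) (dJ : decomposable W J) (Wf : W f).
Hypotheses (uu : unit u) (uv : unit v) (duv : dot u v = 0) (wf : weight u J f).
Implicit Types (s t x y : C).

Let m x y := f (x *: u + y *: v).

Lemma plane_phase s t x y : `|s| = 1 -> `|t| = 1 -> `|x| ^+ 2 + `|y| ^+ 2 = 1 ->
  m (s * x) (t * y) = (s * t^*) ^+ J * m x y.
Proof.
move=> hs ht /(unit_plane _ _ uu uv duv) uz.
have hst : `|s * t^*| = 1 by rewrite norm1M // norm1_conj.
rewrite -(wf hst uz) -(admP admW Wf ht (rfl_unit uu hst uz)).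
rewrite /m rfl_lin rfl_self // rfl_ortho; last by rewrite dotZr duv mulr0.
rewrite scalerDr !scalerA; congr (f (_ *: _ + _)).
transitivity (s * x * (t * t^*)); last ring.
by rewrite unit_norm1 // mulr1.
Qed.

Lemma plane_phase0 x y : `|x| ^+ 2 + `|y| ^+ 2 = 1 -> x * y = 0 -> m x y = 0.
Proof.
move=> h /eqP; have [t ht tJ] := ex_circle_pow_neq1 C J0.
have fin c : c ^+ J != 1 -> m x y = c ^+ J * m x y -> m x y = 0.
  move=> cJ /eqP; rewrite -subr_eq0 -{1}[m x y]mul1r -mulrBl mulf_eq0 subr_eq0 eq_sym.
  by rewrite (negPf cJ) => /eqP.
rewrite mulf_eq0 => /orP[] /eqP E.
  apply: (fin t) => //; have := plane_phase ht (normr1 C) h.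
  by rewrite E mulr0 mul1r rmorph1 mulr1.
apply: (fin t^*); last first.
  by have := plane_phase (normr1 C) ht h; rewrite E mulr0 !mul1r.
by apply: contraNneq tJ => h'; rewrite -[t]conjCK -rmorphXn /= h' rmorph1.
Qed.



(** Conjugating the coordinates multiplies each by a phase. This relates the values on a circle to
    those on the circle with [a] and [b] exchanged. *)
Lemma plane_conj x y : `|x| ^+ 2 + `|y| ^+ 2 = 1 ->
  m x^* y^* * (x * y^*) ^+ J = m x y * (x^* * y) ^+ J.
Proof.
move=> h; have [|] := eqVneq (x * y) 0.
  by move/eqP; rewrite mulf_eq0 => /orP[] /eqP ->;
    rewrite ?rmorph0 ?(mul0r, mulr0) expr0n gtn_eqF // !mulr0.
rewrite mulf_eq0 negb_or => /andP[x0 y0].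
have ph (a : C) : a != 0 -> `|a^* / a| = 1.
  by move=> a0; rewrite normf_div norm_conjC divff // normr_eq0.
have cj (a : C) : a != 0 -> a^* != 0 by rewrite fmorph_eq0.
have {1}-> : x^* = x^* / x * x by rewrite divfK.
have {1}-> : y^* = y^* / y * y by rewrite divfK.
rewrite plane_phase ?ph // mulrAC mulrC -mulrA; congr (_ * _).
rewrite -exprMn; congr (_ ^+ _); rewrite rmorphM fmorphV /= conjCK.
by field; rewrite x0 cj.
Qed.

(** The two points lie at [t = 1] and [t = -1] on a circle [a + t *: b], with [a] their half sum and
    [b] their half difference. There [t ^+ J * f] is a polynomial [N]; exchanging [a] and [b] gives
    [N'], and [plane_conj] yields [N' * A ^+ J = N * B ^+ J] with [A], [B] coprime quadratics. Hence
    [N] is a multiple of [A ^+ J], and on the circle [A] is [t] times the first coordinate times the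
    conjugate of the second. *)
Lemma plane_circle x1 y1 x2 y2 : 0 < x1 -> 0 < y1 -> 0 < x2 -> 0 < y2 ->
  x1 ^+ 2 + y1 ^+ 2 = 1 -> x2 ^+ 2 + y2 ^+ 2 = 1 ->
  m x1 y1 * (x2 * y2) ^+ J = m x2 y2 * (x1 * y1) ^+ J.
Proof.
move=> px1 py1 px2 py2 h1 h2.
have inj_y (a1 b1 a2 b2 : C) : 0 < a1 -> 0 < a2 -> a1 ^+ 2 + b1 ^+ 2 = 1 ->
    a2 ^+ 2 + b2 ^+ 2 = 1 -> b1 ^+ 2 = b2 ^+ 2 -> a1 = a2.
  move=> pa1 pa2 e1 e2 e; apply/eqP; rewrite -(@eqrXn2 _ 2) ?ltW //.
  by rewrite -(inj_eq (addIr (b1 ^+ 2))) e1 e e2.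
have [e|x12] := eqVneq x1 x2.
  by rewrite -e (inj_y y1 x1 y2 x2) // 1?addrC // e.
have y12 : y1 != y2.
  by apply: contra_neq x12 => e; apply: (inj_y x1 y1 x2 y2) => //; rewrite e.
(* Naming these by equations keeps them atomic for [ring]. *)
have [p pE] : exists p, p = (x1 + x2) / 2 by eexists.
have [q qE] : exists q, q = (x1 - x2) / 2 by eexists.
have [p' p'E] : exists p', p' = (y1 + y2) / 2 by eexists.
have [q' q'E] : exists q', q' = (y1 - y2) / 2 by eexists.
have rl (a : C) : 0 < a -> a^* = a by move=> /gtr0_real /conj_Creal.
have half_r (a b : C) : 0 < a -> 0 < b -> ((a + b) / 2)^* = (a + b) / 2.
  by move=> ha hb; rewrite rl // divr_gt0 // addr_gt0.
have half_b (a b : C) : 0 < a -> 0 < b -> ((a - b) / 2)^* = (a - b) / 2.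
  move=> ha hb; by rewrite rmorphM rmorphB /= (rl _ ha) (rl _ hb) rl // invr_gt0.
have pr : p^* = p by rewrite pE half_r.
have qr : q^* = q by rewrite qE half_b.
have p'r : p'^* = p' by rewrite p'E half_r.
have q'r : q'^* = q' by rewrite q'E half_b.
have qn0 : q != 0 by rewrite qE mulf_neq0 ?subr_eq0 // invr_eq0 pnatr_eq0.
have p'n0 : p' != 0 by rewrite p'E gt_eqF // divr_gt0 // addr_gt0.
have pq0 : p * q + p' * q' = 0.
  transitivity (((x1 ^+ 2 + y1 ^+ 2) - (x2 ^+ 2 + y2 ^+ 2)) / 4).
    by rewrite ?pE ?qE ?p'E ?q'E; field.
  by rewrite h1 h2 subrr mul0r.
have pq1 : (p + q) ^+ 2 + (p' + q') ^+ 2 = 1.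
  by rewrite -h1 pE qE p'E q'E; field.
pose a := p *: u + p' *: v; pose b := q *: u + q' *: v.
have ab : dot a b = 0.
  rewrite /a /b !dotDr !dotDl !dotZr !dotZl uu uv duv (conj_dot_eq0 duv) pr p'r.
  by rewrite -[RHS]pq0; ring.
have ba : dot b a = 0 by exact: conj_dot_eq0.
have dab : unit (a + b).
  have -> : a + b = (p + q) *: u + (p' + q') *: v.
    by apply/matrixP => i j; rewrite !mxE; ring.
  apply/(unit_plane _ _ uu uv duv); rewrite !normCK !rmorphD /= pr qr p'r q'r.
  by rewrite -!expr2.
have dba : unit (b + a) by rewrite addrC.
have [N sN hN] := circle_poly dJ Wf ab dab.
have [N' _ hN'] := circle_poly dJ Wf ba dba.
have circ t : `|t| = 1 -> `|p + t * q| ^+ 2 + `|p' + t * q'| ^+ 2 = 1.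
  move=> /unit_norm1 ht; rewrite !normCK !rmorphD !rmorphM /= pr qr p'r q'r.
  transitivity ((p + q) ^+ 2 + (p' + q') ^+ 2
    + (t * t^* - 1) * (q ^+ 2 + q' ^+ 2) + (t + t^* - 2) * (p * q + p' * q')); first ring.
  by rewrite pq1 ht subrr pq0 !(mul0r, mulr0) !addr0.
have at_t t : f (a + t *: b) = m (p + t * q) (p' + t * q').
  by congr f; apply/matrixP => i j; rewrite !mxE; ring.
have key : N' * (lin q p * lin p' q') ^+ J = N * (lin p q * lin q' p') ^+ J.
  apply: poly_circle_eq => t ht; have htt := unit_norm1 ht.
  rewrite !hornerM !horner_exp !hornerM !horner_lin -hN // -hN' //.
  have -> : f (b + t *: a) = m (p + t * q)^* (p' + t * q')^*.
    have tb : b + t *: a = t *: ((p + t^* * q) *: u + (p' + t^* * q') *: v).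
      transitivity ((t * t^*) *: b + t *: a); first by rewrite htt scale1r.
      by apply/matrixP => i j; rewrite !mxE; ring.
    rewrite tb (admP admW Wf ht); last first.
      by apply/(unit_plane _ _ uu uv duv)/circ; rewrite norm1_conj.
    by rewrite !rmorphD !rmorphM /= pr qr p'r q'r.
  have := plane_conj (circ t ht); rewrite at_t => E.
  have -> : q * t + p = p + t * q by ring.
  have -> : q' * t + p' = p' + t * q' by ring.
  transitivity (t ^+ J * t ^+ J *
    (m (p + t * q)^* (p' + t * q')^* * ((p + t * q) * (p' + t * q')^*) ^+ J)).
    have -> : p' * t + q' = t * (p' + t * q')^*.
      rewrite rmorphD rmorphM /= p'r q'r mulrDr mulrA htt mul1r; ring.
    rewrite !exprMn; ring.
  rewrite E; have -> : p * t + q = t * (p + t * q)^*.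
    rewrite rmorphD rmorphM /= pr qr mulrDr mulrA htt mul1r; ring.
  rewrite !exprMn; ring.
(* A zero determinant would make the two points proportional, hence equal, being unit with positive
   coordinates. *)
have det0 : p' * q - q' * p != 0.
  apply: contra_neq x12 => e.
  have xy : x1 * y2 = x2 * y1.
    apply/eqP; rewrite -subr_eq0; apply/eqP; rewrite -[RHS](mulr0 2) -e.
    by rewrite ?pE ?qE ?p'E ?q'E; field.
  apply/eqP; rewrite -(@eqrXn2 _ 2) ?ltW // -subr_eq0; apply/eqP.
  transitivity (x1 ^+ 2 * (x2 ^+ 2 + y2 ^+ 2) - x2 ^+ 2 * (x1 ^+ 2 + y1 ^+ 2)).
    by rewrite h1 h2 !mulr1.
  transitivity ((x1 * y2) ^+ 2 - (x2 * y1) ^+ 2); first ring.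
  by rewrite xy subrr.
have xx0 : x1 * x2 != 0 by rewrite mulf_neq0 ?gt_eqF.
have yy0 : y1 * y2 != 0 by rewrite mulf_neq0 ?gt_eqF.
have cop : coprimep (lin q p * lin p' q') (lin p q * lin q' p').
  rewrite coprimepMl !coprimepMr -!andbA; apply/and4P; split; apply: coprimep_lin.
  - have -> : q * q - p * p = - (x1 * x2) by rewrite pE qE; field.
    by rewrite oppr_eq0.
  - by have -> : q * p' - p * q' = p' * q - q' * p by ring.
  - by [].
  - by have -> : p' * p' - q' * q' = y1 * y2 by rewrite p'E q'E; field.
have sA : size (lin q p * lin p' q') = 3.
  by rewrite size_mul -?size_poly_gt0 !size_lin.
have [k Nk] := coprime_power_cofactor cop sA sN key.
have c1 : m x1 y1 = k * (x1 * y1) ^+ J.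
  have -> : m x1 y1 = N.[1].
    rewrite -hN ?normr1 // expr1n mul1r at_t; congr m; rewrite ?pE ?qE ?p'E ?q'E; by field.
  rewrite Nk hornerZ horner_exp hornerM !horner_lin.
  by congr (_ * _ ^+ _); rewrite ?pE ?qE ?p'E ?q'E; field.
have c2 : m x2 y2 = k * (x2 * y2) ^+ J.
  have -> : m x2 y2 = (-1) ^+ J * N.[-1].
    rewrite -hN ?normrN ?normr1 // mulrA -exprMn mulrNN mulr1 expr1n mul1r at_t.
    by congr m; rewrite ?pE ?qE ?p'E ?q'E; field.
  rewrite Nk hornerZ horner_exp hornerM !horner_lin mulrCA -exprMn.
  by congr (_ * _ ^+ _); rewrite ?pE ?qE ?p'E ?q'E; field.
by rewrite c1 c2; ring.
Qed.

Lemma plane_form : exists c, forall x y, `|x| ^+ 2 + `|y| ^+ 2 = 1 ->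
  f (x *: u + y *: v) = c * (x * y^*) ^+ J.
Proof.
(* A rational point of the unit circle with both coordinates positive serves as reference. *)
pose x2 : C := 3 / 5; pose y2 : C := 4 / 5.
exists (m x2 y2 / (x2 * y2) ^+ J) => x y h; rewrite -/(m x y).
have px2 : 0 < x2 by rewrite divr_gt0.
have py2 : 0 < y2 by rewrite divr_gt0.
have h2 : x2 ^+ 2 + y2 ^+ 2 = 1 by rewrite /x2 /y2; field.
have [xy0|] := eqVneq (x * y) 0.
  rewrite plane_phase0 //; move/eqP: xy0; rewrite mulf_eq0 => /orP[] /eqP ->;
  by rewrite ?rmorph0 ?(mul0r, mulr0) expr0n gtn_eqF // mulr0.
rewrite mulf_eq0 negb_or => /andP[x0 y0].
have ph (a : C) : a != 0 -> `|a / `|a| | = 1.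
  by move=> a0; rewrite normf_div normr_id divff // normr_eq0.
have nr (a : C) : a != 0 -> `|a| != 0 by rewrite normr_eq0.
have {1}-> : x = x / `|x| * `|x| by rewrite divfK // nr.
have {1}-> : y = y / `|y| * `|y| by rewrite divfK // nr.
rewrite plane_phase ?ph ?normr_id //.
have := plane_circle (x1 := `|x|) (y1 := `|y|) _ _ px2 py2 h h2.
rewrite !normr_gt0 => /(_ x0 y0) E.
have xy2 : (x2 * y2) ^+ J != 0 by rewrite expf_neq0 // mulf_neq0 ?gt_eqF.
apply: (mulIf xy2); rewrite -[LHS]mulrA E [LHS]mulrCA -exprMn [RHS]mulrAC divfK //.
congr (_ * _ ^+ _); rewrite rmorphM fmorphV /= conj_normC.
by field; rewrite !nr.
Qed.

End PlaneLemma.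

(** * The function of extremal weight on the whole sphere *)

Section HighestWeightFunction.
Variables (C : numClosedFieldType) (d : nat) (W : ('cV[C]_d -> C) -> Prop).
Hypothesis admW : admissible W.
Implicit Types (a b e p q u v z w : 'cV[C]_d) (c s t x y r : C) (F f h : 'cV[C]_d -> C).

(** The second symmetry fixes [u], which is orthogonal to both [g1 q] and [v]. *)
Lemma symmetry_carry2 p q u v : unit p -> unit q -> dot p q = 0 ->
  unit u -> unit v -> dot u v = 0 ->
  exists g, [/\ symmetry W g, g p = u & g q = v].
Proof.
move=> up uq pq uu uv duv.
have [g1 [s1 e1 _]] := symmetry_carry admW up uu.
have uq1 : unit (g1 q) by exact: (symmetry_unit s1 uq).
have [g2 [s2 e2 f2]] := symmetry_carry admW uq1 uv.
exists (g2 \o g1); split=> //=; first exact: symmetry_comp.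
rewrite e1; apply: f2; last exact: conj_dot_eq0.
by apply: conj_dot_eq0; rewrite -e1; case: s1 => _ -> _ _.
Qed.

Lemma weight_ortho0 J u f z : (0 < J)%N -> weight u J f -> unit z ->
  (forall t, `|t| = 1 -> f (rfl u t z) = f z) -> f z = 0.
Proof.
move=> J0 wf uz h; have [t ht tJ] := ex_circle_pow_neq1 C J0.
have := wf t z ht uz; rewrite h // => /eqP.
rewrite -subr_eq0 -{1}[f z]mul1r -mulrBl mulf_eq0 subr_eq0 eq_sym (negPf tJ).
by move/eqP.
Qed.

Section Pair.
Variables (J : nat) (p q : 'cV[C]_d) (h : 'cV[C]_d -> C).
Hypotheses (J0 : (0 < J)%N) (dJ : decomposable W J) (Wh : W h).
Hypotheses (up : unit p) (uq : unit q) (dpq : dot p q = 0).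
Hypothesis wp : weight p J h.
Implicit Types l : C.

Lemma unit3 e x y r : unit e -> dot p e = 0 -> dot q e = 0 ->
  unit (x *: p + y *: q + r *: e) <-> `|x| ^+ 2 + `|y| ^+ 2 + `|r| ^+ 2 = 1.
Proof.
rewrite /unit => ue pe qe.
rewrite !dotDr !dotDl !dotZr !dotZl up uq ue dpq pe qe.
rewrite (conj_dot_eq0 dpq) (conj_dot_eq0 pe) (conj_dot_eq0 qe) !normCK.
by rewrite !mulr0 !mulr1 !addr0 !add0r.
Qed.

(** Both points lie in the plane of [p] and [y *: q + r *: e], where [plane_form] has one
    constant. *)
Lemma ratio_fst e x x' y r l : unit e -> dot p e = 0 -> dot q e = 0 ->
  `|x| ^+ 2 + `|y| ^+ 2 + `|r| ^+ 2 = 1 ->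
  `|x'| ^+ 2 + `|l * y| ^+ 2 + `|l * r| ^+ 2 = 1 -> r != 0 ->
  h (x *: p + y *: q + r *: e) * (x' * (l * y)^*) ^+ J =
  h (x' *: p + (l * y) *: q + (l * r) *: e) * (x * y^*) ^+ J.
Proof.
move=> ue pe qe h1 h2 r0.
have w0 : y *: q + r *: e != 0.
  apply: contra_neq r0 => E; have := congr1 (dot e) E.
  by rewrite dotDr !dotZr ue (conj_dot_eq0 qe) dot0r mulr0 add0r mulr1.
have [n [v [n0 nn uv wE]]] := ex_unit_dir w0.
have pv : dot p v = 0.
  have : dot p (y *: q + r *: e) = 0 by rewrite dotDr !dotZr dpq pe !mulr0 addr0.
  by rewrite wE dotZr => /eqP; rewrite mulf_eq0 gt_eqF // => /eqP.
have [c hc] := plane_form admW J0 dJ Wh up uv pv wp.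
have E1 : x *: p + y *: q + r *: e = x *: p + n *: v by rewrite -addrA wE.
have E2 : x' *: p + (l * y) *: q + (l * r) *: e = x' *: p + (l * n) *: v.
  by rewrite -addrA -!scalerA -scalerDr wE.
rewrite E1 E2 !hc; first by rewrite !rmorphM /= !exprMn; ring.
  by apply/(unit_plane _ _ up uv pv); rewrite -E1; apply/unit3.
by apply/(unit_plane _ _ up uv pv); rewrite -E2; apply/unit3.
Qed.

End Pair.

Section PairForm.
Variables (J : nat) (p q : 'cV[C]_d) (h : 'cV[C]_d -> C).
Hypotheses (J0 : (0 < J)%N) (dJ : decomposable W J) (Wh : W h).
Hypotheses (up : unit p) (uq : unit q) (dpq : dot p q = 0).
Hypotheses (wp : weight p J h) (wq : weight q J (fun z => (h z)^*)).
Implicit Types l : C.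

(** Conjugating [h] exchanges the roles of [p] and [q]. *)
Lemma ratio_snd e x y y' r l : unit e -> dot p e = 0 -> dot q e = 0 ->
  `|x| ^+ 2 + `|y| ^+ 2 + `|r| ^+ 2 = 1 ->
  `|l * x| ^+ 2 + `|y'| ^+ 2 + `|l * r| ^+ 2 = 1 -> r != 0 ->
  h (x *: p + y *: q + r *: e) * ((l * x) * y'^*) ^+ J =
  h ((l * x) *: p + y' *: q + (l * r) *: e) * (x * y^*) ^+ J.
Proof.
move=> ue pe qe h1 h2 r0; apply: (inv_inj (@conjCK C)).
rewrite /= [LHS]rmorphM [RHS]rmorphM /= !rmorphXn /=.
have cE (s t : C) : (s * t^*)^* = t * s^* by rewrite rmorphM /= conjCK mulrC.
rewrite !cE [x *: p + _]addrC [(l * x) *: p + _]addrC.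
apply: (ratio_fst (h := fun z => (h z)^*) J0 dJ (admC admW Wh) uq up (conj_dot_eq0 dpq) wq) => //.
  by rewrite [_ + `|x| ^+ 2]addrC.
by rewrite [_ + `|l * x| ^+ 2]addrC.
Qed.

(* The quotient of [h] by [(x * y^* ) ^+ J] depends only on [r / y] by the form
   of [h] on planes through [p], and only on [r / x] by that on planes through
   [q]. *)
Lemma ratio_const e x y r x' y' r' : unit e -> dot p e = 0 -> dot q e = 0 ->
  `|x| ^+ 2 + `|y| ^+ 2 + `|r| ^+ 2 = 1 -> `|x'| ^+ 2 + `|y'| ^+ 2 + `|r'| ^+ 2 = 1 ->
  y != 0 -> r != 0 -> x' != 0 -> r' != 0 ->
  h (x *: p + y *: q + r *: e) * (x' * y'^*) ^+ J =
  h (x' *: p + y' *: q + r' *: e) * (x * y^*) ^+ J.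
Proof.
move=> ue pe qe h1 h2 y0 r0 x'0 r'0.
(* The intermediate point, proportional to [(x' / r', y / r, 1)], shares the ratio [r / y] with the
   first point and [r' / x'] with the second. *)
pose n2 := `|x' / r'| ^+ 2 + `|y / r| ^+ 2 + 1.
have n20 : 0 < n2 by rewrite ltr_wpDl // addr_ge0 // exprn_ge0.
have [o o0 on] : exists2 o : C, o != 0 & `|o| ^+ 2 * n2 = 1.
  exists (sqrtC n2)^-1; first by rewrite invr_eq0 sqrtC_eq0 gt_eqF.
  rewrite normfV exprVn -normrX sqrtCK gtr0_norm // mulVf // gt_eqF //.
have H3 : `|o * (x' / r')| ^+ 2 + `|o * (y / r)| ^+ 2 + `|o| ^+ 2 = 1.
  by rewrite !normrM !exprMn -on /n2 !normrM !exprMn; ring.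
have A1 : o / r * y = o * (y / r) by field.
have A2 : o / r * r = o by field.
have B1 : o / r' * x' = o * (x' / r') by field.
have B2 : o / r' * r' = o by field.
have := @ratio_fst J p q h J0 dJ Wh up uq dpq wp e x (o * (x' / r')) y r (o / r) ue pe qe h1.
rewrite A1 A2 => /(_ H3 r0) E1.
have := @ratio_snd e x' y' (o * (y / r)) r' (o / r') ue pe qe h2.
rewrite B1 B2 => /(_ H3 r'0) E2.
set m := h (_ *: p + _ *: q + o *: e) in E1 E2.
set k := (o * (x' / r') * _) ^+ J in E1 E2.
have k0 : k != 0.
  by rewrite expf_neq0 // !mulf_neq0 ?invr_eq0 // fmorph_eq0 !mulf_neq0 ?invr_eq0.
apply: (mulIf k0); rewrite mulrAC E1 [RHS]mulrAC E2; ring.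
Qed.

(** [ratio_const] only compares points with nonzero [e]-coordinate. A circle that meets the plane of
    [p] and [q] at [t = 1] brings in the constant [c]. *)
Lemma pair_form_off c e x y r : unit e -> dot p e = 0 -> dot q e = 0 ->
  (forall x y, `|x| ^+ 2 + `|y| ^+ 2 = 1 -> h (x *: p + y *: q) = c * (x * y^*) ^+ J) ->
  `|x| ^+ 2 + `|y| ^+ 2 + `|r| ^+ 2 = 1 -> x != 0 -> y != 0 -> r != 0 ->
  h (x *: p + y *: q + r *: e) = c * (x * y^*) ^+ J.
Proof.
move=> ue pe qe hc h1 x0 y0 r0.
(* Since [x1^2 + (2 o)^2 = 1], the points [x1 *: p + (o * (1 + t)) *: q + (o * (1 - t)) *: e] are
   unit for all [t] on the circle. *)
have [x1 x1E] : exists x1 : C, x1 = 3 / 5 by eexists.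
have [o oE] : exists o : C, o = 2 / 5 by eexists.
have fifth (n : nat) : (n%:R / 5 : C)^* = n%:R / 5.
  by rewrite rmorphM fmorphV /= !conjC_nat.
have x1r : x1^* = x1 by rewrite x1E fifth.
have orr : o^* = o by rewrite oE fifth.
have x10 : x1 != 0 by rewrite x1E mulf_neq0 ?invr_eq0 ?pnatr_eq0.
have o0 : o != 0 by rewrite oE mulf_neq0 ?invr_eq0 ?pnatr_eq0.
pose a := x1 *: p + o *: q + o *: e; pose b := o *: q - o *: e.
have abE : a + b = x1 *: p + (o * 2) *: q + 0 *: e.
  by apply/matrixP => i j; rewrite !mxE; ring.
have ab : dot a b = 0.
  rewrite /a /b !dotBr !dotDl !dotZr !dotZl uq ue dpq pe qe (conj_dot_eq0 qe) orr; ring.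
have circ t : `|t| = 1 ->
    `|x1| ^+ 2 + `|o * (1 + t)| ^+ 2 + `|o * (1 - t)| ^+ 2 = 1.
  move=> /unit_norm1 ht; rewrite !normCK !rmorphM rmorphB rmorphD /= rmorph1 x1r orr.
  transitivity (x1 ^+ 2 + 4 * o ^+ 2 + 2 * o ^+ 2 * (t * t^* - 1)); first ring.
  by rewrite ht subrr mulr0 addr0 x1E oE; field.
have uab : unit (a + b).
  have := circ 1 (normr1 _); rewrite subrr mulr0 abE => E.
  by apply/unit3 => //; rewrite -E.
have at_t t : a + t *: b = x1 *: p + (o * (1 + t)) *: q + (o * (1 - t)) *: e.
  by apply/matrixP => i j; rewrite !mxE; ring.
have [N _ hN] := circle_poly dJ Wh ab uab.
set k := h (x *: p + y *: q + r *: e).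
have key : N * ((x * y^*) ^+ J)%:P = (k * (x1 * o) ^+ J) *: (lin 1 1) ^+ J.
  apply/eqP; rewrite -subr_eq0; apply/eqP.
  (* The factor ['X^2 - 1] discards [t = 1] and [t = -1], where a coordinate vanishes and
     [ratio_const] does not apply. *)
  have P0 : 'X^2 - 1 != 0 :> {poly C}.
    by rewrite -size_poly_eq0 size_XnsubC.
  apply: (mulIf P0); rewrite mul0r; apply: poly_circle_eq0 => n.
  set t := circ_pt C n; have ht : `|t| = 1 by exact: norm_circ_pt.
  have htt := unit_norm1 ht.
  rewrite [(_ * _).[_]]hornerM !hornerD !hornerN hornerXn hornerZ horner_exp horner_lin [(N * _).[_]]hornerM !hornerC -hN // at_t mul1r.
  have [t1|t1] := eqVneq (t ^+ 2) 1; first by rewrite t1 subrr mulr0.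
  have : (1 + t) * (1 - t) != 0.
    have -> : (1 + t) * (1 - t) = 1 - t ^+ 2 by ring.
    by rewrite subr_eq0 eq_sym.
  rewrite mulf_eq0 negb_or => /andP[tp tm].
  have := ratio_const ue pe qe (circ t ht) h1 (mulf_neq0 o0 tp) (mulf_neq0 o0 tm) x0 r0.
  rewrite -/k => E; rewrite -[t ^+ J * _ * _]mulrA E.
  have -> : t + 1 = t * (1 + t)^* by rewrite rmorphD /= rmorph1 mulrDr htt mulr1.
  by rewrite rmorphM /= orr !exprMn; ring.
have := congr1 (fun P : {poly C} => P.[1]) key.
rewrite hornerM hornerC hornerZ horner_exp horner_lin -hN ?normr1 //.
rewrite expr1n mul1r scale1r abE scale0r addr0 hc; last first.
  by have := circ 1 (normr1 _); rewrite subrr mulr0 normr0 expr0n addr0.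
rewrite rmorphM /= orr conjC_nat => E.
have nz : (x1 * o * 2) ^+ J != 0 by rewrite expf_neq0 // !mulf_neq0 ?pnatr_eq0.
apply: (mulfI nz); transitivity (c * (x1 * (o * 2)) ^+ J * (x * y^*) ^+ J); last first.
  by rewrite !mulrA; ring.
rewrite E mulr1 -!mulrA.
by rewrite [(1 + 1)%R]/(2 : C) !exprMn; ring.
Qed.

Lemma pair_form c :
  (forall x y, `|x| ^+ 2 + `|y| ^+ 2 = 1 -> h (x *: p + y *: q) = c * (x * y^*) ^+ J) ->
  forall z, unit z -> h z = c * (dot p z * (dot q z)^*) ^+ J.
Proof.
move=> hc z uz; set x := dot p z; set y := dot q z.
have [x0|x0] := eqVneq x 0.
  rewrite x0 mul0r expr0n gtn_eqF // mulr0; apply: (weight_ortho0 J0 wp uz) => t _.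
  by rewrite rfl_ortho.
have [y0|y0] := eqVneq y 0.
  rewrite y0 rmorph0 mulr0 expr0n gtn_eqF // mulr0; apply/eqP.
  rewrite -(fmorph_eq0 (@Num.conj C)); apply/eqP; apply: (weight_ortho0 J0 wq uz) => t _.
  by rewrite rfl_ortho.
pose w := z - x *: p - y *: q.
have zE : z = x *: p + y *: q + w.
  by apply/matrixP => i j; rewrite !mxE; ring.
have pw : dot p w = 0 by rewrite !dotBr !dotZr up dpq -/x; ring.
have qw : dot q w = 0 by rewrite !dotBr !dotZr uq (conj_dot_eq0 dpq) -/y; ring.
have [w0|/ex_unit_dir[r [e [r0 _ ue wE]]]] := eqVneq w 0.
  rewrite zE w0 addr0 hc //; apply/(unit_plane _ _ up uq dpq).
  by rewrite -[_ + _]addr0 -w0 -zE.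
have rn0 : r != 0 by rewrite gt_eqF.
have pe : dot p e = 0.
  by move: pw; rewrite wE dotZr => /eqP; rewrite mulf_eq0 (negPf rn0) => /eqP.
have qe : dot q e = 0.
  by move: qw; rewrite wE dotZr => /eqP; rewrite mulf_eq0 (negPf rn0) => /eqP.
rewrite zE wE; apply: pair_form_off => //.
by apply/(unit3 up uq dpq x y r ue pe qe); rewrite -wE -zE.
Qed.

End PairForm.

(** On a suitable plane [f] is a nonzero multiple of the desired power, and a symmetry moves this
    plane to [p], [q]. The component of weight [-J] along [q] keeps its weight along [p], because
    the reflections commute, and its values on the plane, where that weight is already attained;
    [pair_form] then determines it everywhere. *)
Lemma extremal_pair J u f z0 : (0 < J)%N -> decomposable W J ->
  unit u -> W f -> unit z0 -> f z0 != 0 -> weight u J f ->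
  forall p q, unit p -> unit q -> dot p q = 0 ->
  W (fun z => (dot p z * (dot q z)^*) ^+ J).
Proof.
move=> J0 dJ uu Wf uz0 fz0 wf p q up uq dpq.
pose x0 := dot u z0; pose w := z0 - x0 *: u.
have z0E : z0 = x0 *: u + w by rewrite addrC subrK.
have uw : dot u w = 0 by rewrite dotBr dotZr uu mulr1 subrr.
(* On multiples of [u] the reflections along [u] only change the phase, so [f] vanishes there. *)
have w0 : w != 0.
  apply: contraNneq fz0 => w0; apply/eqP; apply: (weight_ortho0 J0 wf uz0) => t ht.
  have E : z0 = x0 *: u by rewrite z0E w0 addr0.
  have -> : rfl u t z0 = t *: z0.
    by rewrite E -[x0 *: u]addr0 rfl_lin rfl_self // rfl_ortho ?dot0r // !addr0 !scalerA mulrC.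
  exact: (admP admW).
have [n [v [n0 _ uv wE]]] := ex_unit_dir w0.
have duv : dot u v = 0.
  by move: uw; rewrite wE dotZr => /eqP; rewrite mulf_eq0 gt_eqF // => /eqP.
have [c hc] := plane_form admW J0 dJ Wf uu uv duv wf.
have cn0 : c != 0.
  apply: contraNneq fz0 => c0; rewrite z0E wE hc ?c0 ?mul0r //.
  by apply/(unit_plane _ _ uu uv duv); rewrite -wE -z0E.
have [g [sg gp gq]] := symmetry_carry2 up uq dpq uu uv duv.
pose f1 := f \o g; have Wf1 : W f1 by case: sg => _ _ _; apply.
have wf1 : weight p J f1.
  move=> t z ht uz; rewrite /f1 /= (symmetry_rflE _ _ _ sg) gp wf //.
  exact: (symmetry_unit sg uz).
have hc1 x y : `|x| ^+ 2 + `|y| ^+ 2 = 1 -> f1 (x *: p + y *: q) = c * (x * y^*) ^+ J.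
  by move=> h; rewrite /f1 /= (symmetryD _ _ sg) !(symmetryZ _ _ sg) gp gq hc.
have [G WG hG] := dJ q f1 uq Wf1.
have w_q : weight q J (fun z => (G 0%N z)^*).
  move=> t z ht uz; have := decomp_coef_weight uq hG (n := 0) isT ht uz.
  rewrite expr0 mul1r => <-.
  by rewrite rmorphM rmorphXn /= mulrA -exprMn unit_norm1 // expr1n mul1r.
have w_p : weight p J (G 0%N).
  move=> s z hs uz.
  apply: (circle_coef (N := J.*2.+1) (a := fun n => G n (rfl p s z))
    (b := fun n => s ^+ J * G n z)) => // t ht.
  rewrite -hG //; last exact: rfl_unit.
  rewrite -(rflC _ _ _ dpq) wf1 //; last exact: rfl_unit.
  rewrite mulrCA hG // mulr_sumr; apply: eq_bigr => i _; exact: mulrCA.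
have hcG x y : `|x| ^+ 2 + `|y| ^+ 2 = 1 -> G 0%N (x *: p + y *: q) = c * (x * y^*) ^+ J.
  move=> h; have uz : unit (x *: p + y *: q) by apply/(unit_plane _ _ up uq dpq).
  rewrite -[RHS]mul1r; apply: (circle_coef (N := J.*2.+1) (a := fun n => G n (x *: p + y *: q))
    (b := fun n => (n == 0%N)%:R * (c * (x * y^*) ^+ J)) _ (n := 0%N)) => // t ht.
  rewrite -hG // big_ord_recl /= expr0 !mul1r big1 ?addr0; last first.
    by move=> i _; rewrite /= mul0r mulr0.
  have -> : rfl q t (x *: p + y *: q) = x *: p + (t * y) *: q.
    rewrite addrC rfl_lin rfl_self // rfl_ortho; last by rewrite dotZr (conj_dot_eq0 dpq) mulr0.
    by rewrite addrC scalerA mulrC.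
  rewrite hc1; last by rewrite normrM ht mul1r.
  rewrite mulrCA -exprMn; congr (_ * _ ^+ _); rewrite rmorphM /=.
  by transitivity (x * y^* * (t * t^*)); [ring | rewrite unit_norm1 // mulr1].
have := admZ admW c^-1 (WG 0%N); apply: (admX admW) => z uz.
by rewrite (pair_form J0 dJ (WG 0%N) up uq dpq w_p w_q hcG uz) mulKf.
Qed.

(** Each coefficient is a fixed linear combination of the values at [N] distinct [t], by inverting a
    Vandermonde matrix. *)
Lemma adm_coef N (a : nat -> 'cV[C]_d -> C) :
  (forall t, W (fun z => \sum_(i < N) t ^+ i * a i z)) ->
  forall i, (i < N)%N -> W (a i).
Proof.
move=> h i iN; pose A := Vandermonde N (\row_(j < N) circ_pt C j).
have uA : A \in unitmx.
  rewrite unitmxE unitfE det_Vandermonde; apply/prodf_neq0 => j _.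
  apply/prodf_neq0 => k jk; rewrite !mxE subr_eq0.
  by apply: contraTneq jk => /circ_pt_inj ->; rewrite ltnn.
have := adm_sum admW (fun j => invmx A j (Ordinal iN)) (fun j : 'I_N => h (circ_pt C j)).
apply: (admX admW) => z _; rewrite (eq_bigr (fun j => \sum_(k < N) a k z * (A k j * invmx A j (Ordinal iN)))).
  rewrite exchange_big /= (bigD1 (Ordinal iN)) //= [X in _ + X]big1 ?addr0.
    rewrite -mulr_sumr; have := congr1 (fun B : 'M_N => B (Ordinal iN) (Ordinal iN)) (mulmxV uA).
    by rewrite !mxE eqxx => ->; rewrite mulr1.
  move=> k ki; rewrite -mulr_sumr; have := congr1 (fun B : 'M_N => B k (Ordinal iN)) (mulmxV uA).
  by rewrite !mxE (negPf ki) => ->; rewrite mulr0.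
by move=> j _; rewrite mulr_sumr; apply: eq_bigr => k _; rewrite !mxE; ring.
Qed.

(** Polarization: up to the factor [J], this is the derivative in [t] at 0. *)
Lemma adm_binom_coef1 J (A B Q : 'cV[C]_d -> C) : (0 < J)%N ->
  (forall t, W (fun z => (A z + t * B z) ^+ J * Q z)) ->
  W (fun z => A z ^+ J.-1 * B z * Q z).
Proof.
move=> J0 h.
have : W (fun z => (A z ^+ (J - 1) * B z ^+ 1) *+ 'C(J, 1) * Q z).
  apply: (adm_coef (N := J.+1)
    (a := fun i z => (A z ^+ (J - i) * B z ^+ i) *+ 'C(J, i) * Q z)) => // t.
  have := h t; apply: (admX admW) => z _; rewrite exprDn mulr_suml.
  apply: eq_bigr => i _; rewrite exprMn !mulrnAl mulrnAr.
  by congr (_ *+ _); ring.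
move/(admZ admW J%:R^-1); apply: (admX admW) => z _.
rewrite bin1 subn1 expr1 mulrnAl -mulr_natr.
by field; rewrite pnatr_eq0 -lt0n.
Qed.

(* The 2x2 minor is what vanishes on product states. *)
Lemma minor_function J q : (1 < J)%N -> unit q ->
  (forall p, unit p -> dot p q = 0 -> W (fun z => (dot p z * (dot q z)^*) ^+ J)) ->
  forall a b u v, dot a q = 0 -> dot b q = 0 -> dot u q = 0 -> dot v q = 0 ->
  W (fun z => dot a z ^+ (J - 2) * (dot a z * dot b z - dot u z * dot v z) *
              (dot q z)^* ^+ J).
Proof.
move=> J1 uq h a b u v aq bq uq0 vq.
have J0 : (0 < J)%N by exact: ltnW.
have H l : dot l q = 0 -> W (fun z => dot l z ^+ J * (dot q z)^* ^+ J).
  move=> lq; have [->|/ex_unit_dir[n [p [n0 _ up lE]]]] := eqVneq l 0.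
    by have := adm0 admW; apply: (admX admW) => z _; rewrite dot0l expr0n gtn_eqF // mul0r.
  have pq : dot p q = 0.
    move: lq; rewrite lE dotZl => /eqP; rewrite mulf_eq0 fmorph_eq0 gt_eqF //= => /eqP.
    by [].
  have := admZ admW (n^* ^+ J) (h p up pq); apply: (admX admW) => z _.
  by rewrite lE dotZl !exprMn mulrA.
have comb l m t : dot l q = 0 -> dot m q = 0 -> dot (l + t^* *: m) q = 0.
  by move=> lq mq; rewrite dotDl dotZl lq mq mulr0 addr0.
have combE l m t z : dot (l + t^* *: m) z = dot l z + t * dot m z.
  by rewrite dotDl dotZl conjCK.
have H1 l m : dot l q = 0 -> dot m q = 0 ->
    W (fun z => dot l z ^+ J.-1 * dot m z * (dot q z)^* ^+ J).
  move=> lq mq; apply: adm_binom_coef1 => // t.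
  have := H _ (comb l m t lq mq); apply: (admX admW) => z _; by rewrite combE.
(* The second polarization acts on the power [J.-1], which [J >= 2] makes positive. *)
have H2 l m k : dot l q = 0 -> dot m q = 0 -> dot k q = 0 ->
    W (fun z => dot l z ^+ J.-1.-1 * dot m z * (dot k z * (dot q z)^* ^+ J)).
  move=> lq mq kq; apply: adm_binom_coef1 => [|t]; first by rewrite -subn1 subn_gt0.
  have := H1 _ _ (comb l m t lq mq) kq; apply: (admX admW) => z _.
  by rewrite combE mulrA.
have := admB admW (H1 a b aq bq) (H2 a u v aq uq0 vq); apply: (admX admW) => z _.
have -> : J.-1 = (J - 2).+1 by lia.
by rewrite /= exprS; ring.
Qed.

End HighestWeightFunction.

(** * Only weights -1, 0, 1: the Born form *)

Section BornForm.
Variables (C : numClosedFieldType) (d : nat) (W : ('cV[C]_d -> C) -> Prop).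
Hypotheses (admW : admissible W) (d1 : decomposable W 1).
Implicit Types (a b e u v z w : 'cV[C]_d) (c s t x y : C) (F f : 'cV[C]_d -> C).

(** Only the moduli of [x] and [y] matter, and the circle through [u] ([t = 1]) and [v] ([t = -1])
    realizes every pair of moduli. There [t * f] is quadratic, so [f] is affine in the real part of
    [t], which is [|x|^2 - |y|^2]. *)
Lemma plane_weight0 u v f : W f -> unit u -> unit v -> dot u v = 0 -> weight u 0 f ->
  exists al be, forall x y, `|x| ^+ 2 + `|y| ^+ 2 = 1 ->
    f (x *: u + y *: v) = al * `|x| ^+ 2 + be * `|y| ^+ 2.
Proof.
move=> Wf uu uv duv wf.
have ph s t x y : `|s| = 1 -> `|t| = 1 -> `|x| ^+ 2 + `|y| ^+ 2 = 1 ->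
    f ((s * x) *: u + (t * y) *: v) = f (x *: u + y *: v).
  by move=> hs ht h; rewrite (plane_phase admW Wf uu uv duv wf) // expr0 mul1r.
have half_r : (2^-1 : C)^* = 2^-1 by rewrite fmorphV /= conjC_nat.
pose a := 2^-1 *: u + 2^-1 *: v; pose b := 2^-1 *: u - 2^-1 *: v.
have ab : dot a b = 0.
  rewrite /a /b !dotBr !dotDl !dotZr !dotZl uu uv duv (conj_dot_eq0 duv); ring.
have uab : unit (a + b).
  have -> : a + b = u by apply/matrixP => i j; rewrite !mxE; field.
  by [].
have [N sN hN] := circle_poly d1 Wf ab uab.
have NE t : N.[t] = N`_0 + N`_1 * t + N`_2 * t ^+ 2.
  rewrite (@horner_coef_wide _ 3) // !big_ord_recr big_ord0 /= add0r expr0 mulr1.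
  by rewrite expr1.
exists (N`_1 + (N`_0 + N`_2)), (N`_1 - (N`_0 + N`_2)) => x y h.
(* With [t = o ^+ 2], the coordinates [(1 + t) / 2] and [(1 - t) / 2] have moduli [|x|] and [|y|];
   [t^*] gives the same moduli, and averaging the two equations leaves [t + t^*]. *)
pose o := `|x| + 'i * `|y|; pose t := o ^+ 2.
have o_conj : o^* = `|x| - 'i * `|y|.
  by rewrite rmorphD rmorphM /= conjCi !conj_normC mulNr.
have ii : 'i * 'i = -1 :> C by rewrite -expr2 sqrCi.
have oo : o * o^* = 1.
  rewrite o_conj -h /o; transitivity (`|x| ^+ 2 - ('i * 'i) * `|y| ^+ 2); first ring.
  by rewrite ii; ring.
have o1 : `|o| = 1.
  by apply/eqP; rewrite -(@eqrXn2 _ 2) // normCK oo expr1n.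
have oc1 : `|o^*| = 1 by rewrite norm_conjC.
have ht : `|t| = 1 by exact: norm1_exp.
have htc : `|t^*| = 1 by rewrite norm_conjC.
pose g := f (x *: u + y *: v).
have mod1 (c : C) (k : C) : `|k| = 1 -> exists2 s, `|s| = 1 & s * c = k * `|c|.
  move=> k1; have [->|c0] := eqVneq c 0.
    by exists 1; rewrite ?normr1 // normr0 !mulr0.
  exists (k * `|c| / c); last by rewrite divfK.
  by rewrite normf_div normrM k1 normr_id mul1r divff // normr_eq0.
have gE k l : `|k| = 1 -> `|l| = 1 ->
    f ((k * `|x|) *: u + (l * `|y|) *: v) = g.
  move=> k1 l1; have [s hs <-] := mod1 x k k1; have [r hr <-] := mod1 y l l1.
  exact: ph.
have abE s : a + s *: b = ((1 + s) / 2) *: u + ((1 - s) / 2) *: v.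
  by apply/matrixP => i j; rewrite !mxE; field.
have e1 : a + t *: b = (o * `|x|) *: u + ((- 'i * o) * `|y|) *: v.
  rewrite abE; congr (_ *: u + _ *: v); rewrite /t.
    transitivity ((o * o^* + o ^+ 2) / 2); first by rewrite oo.
    by rewrite o_conj /o; field.
  transitivity ((o * o^* - o ^+ 2) / 2); first by rewrite oo.
  by rewrite o_conj /o; field.
have e2 : a + t^* *: b = (o^* * `|x|) *: u + (('i * o^*) * `|y|) *: v.
  rewrite abE; congr (_ *: u + _ *: v); rewrite /t rmorphXn /=.
    transitivity ((o * o^* + o^* ^+ 2) / 2); first by rewrite oo.
    by rewrite o_conj /o; field.
  transitivity ((o * o^* - o^* ^+ 2) / 2); first by rewrite oo.
  by rewrite o_conj /o; field.
have i1 : `|'i : C| = 1 by exact: normCi.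
have E1 : t * g = N.[t].
  rewrite -hN // expr1 e1 gE //; by rewrite norm1M ?normrN.
have E2 : t^* * g = N.[t^*].
  rewrite -hN // expr1 e2 gE //; by rewrite norm1M.
have tt := unit_norm1 ht.
have g2 : 2 * g = 2 * N`_1 + (N`_0 + N`_2) * (t + t^*).
  transitivity (t^* * (t * g) + t * (t^* * g)).
    by transitivity (2 * (t * t^*) * g); [rewrite tt mulr1 | ring].
  rewrite E1 E2 !NE.
  transitivity ((t * t^*) * (2 * N`_1 + N`_2 * (t + t^*)) + N`_0 * (t + t^*)); first ring.
  rewrite tt; ring.
have tE : t + t^* = 2 * (`|x| ^+ 2 - `|y| ^+ 2).
  rewrite /t rmorphXn /= o_conj /o.
  transitivity (2 * (`|x| ^+ 2 + ('i * 'i) * `|y| ^+ 2)); first ring.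
  rewrite ii; ring.
have two0 : 2 != 0 :> C by rewrite pnatr_eq0.
apply: (mulfI two0); rewrite -/g g2 tE -[2 * N`_1]mulr1 -h; ring.
Qed.

Definition form4 (k : C * C * C * C) x y :=
  k.1.1.1 * (x * x^*) + k.1.1.2 * (y * y^*) + k.1.2 * (x * y^*) + k.2 * (x^* * y).

(** Weights 1 and -1 give the cross terms by [plane_form] with exponent 1, the latter after
    conjugation; weight 0 gives the squared moduli. *)
Lemma plane_quadratic u v F : W F -> unit u -> unit v -> dot u v = 0 ->
  exists k, forall x y, `|x| ^+ 2 + `|y| ^+ 2 = 1 -> F (x *: u + y *: v) = form4 k x y.
Proof.
move=> WF uu uv duv.
have [G WG hG] := d1 uu WF.
have wG := decomp_coef_weight uu hG.
have w2 : weight u 1 (G 2).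
  move=> t z ht uz; apply: (mulfI (norm1_neq0 ht)).
  by have := wG 2%N t z isT ht uz; rewrite !expr1 => ->; rewrite mulrA.
have w1 : weight u 0 (G 1%N).
  move=> t z ht uz; apply: (mulfI (norm1_neq0 ht)).
  by have := wG 1%N t z isT ht uz; rewrite !expr1 => ->; rewrite expr0 mul1r.
have w0 : weight u 1 (fun z => (G 0%N z)^*).
  move=> t z ht uz; have := wG 0%N t z isT ht uz; rewrite expr0 mul1r => <-.
  by rewrite rmorphM rmorphXn /= mulrA -exprMn unit_norm1 // expr1n mul1r.
have [c2 h2] := plane_form admW (ltn0Sn 0) d1 (WG 2%N) uu uv duv w2.
have [c0 h0] := plane_form admW (ltn0Sn 0) d1 (admC admW (WG 0%N)) uu uv duv w0.
have [al [be h1]] := plane_weight0 (WG 1%N) uu uv duv w1.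
exists (al, be, c2, c0^*) => x y h; rewrite /form4 /=.
have uz : unit (x *: u + y *: v) by apply/(unit_plane _ _ uu uv duv).
have := hG 1 _ (normr1 _) uz; rewrite rfl1 expr1n mul1r => ->.
rewrite !big_ord_recr big_ord0 /= !expr1n !mul1r add0r h1 // h2 //.
rewrite -[G 0%N _]conjCK h0 // !expr1 !rmorphM /= conjCK !normCK; ring.
Qed.

Section Extension.
Variable F : 'cV[C]_d -> C.
Hypothesis WF : W F.

(** The extension homogeneous of degree 2, so that sums of vectors make sense. *)
Definition hext z := dot z z * F ((sqrtC (dot z z))^-1 *: z).

Lemma hext_unit z : unit z -> hext z = F z.
Proof. by rewrite /hext => ->; rewrite sqrtC1 invr1 scale1r mul1r. Qed.

Lemma hext_plane u v : unit u -> unit v -> dot u v = 0 ->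
  exists k, forall x y, hext (x *: u + y *: v) = form4 k x y.
Proof.
move=> uu uv duv; have [k hk] := plane_quadratic WF uu uv duv.
exists k => x y; rewrite /hext; set D := dot _ _.
have DE : D = x * x^* + y * y^*.
  rewrite /D !dotDr !dotDl !dotZr !dotZl uu uv duv (conj_dot_eq0 duv); ring.
have [D0|D0] := eqVneq D 0.
  have /eqP : x * x^* + y * y^* = 0 by rewrite -DE.
  rewrite -!normCK paddr_eq0 ?exprn_ge0 // !expf_eq0 /= !normr_eq0.
  move=> /andP[/eqP-> /eqP->].
  by rewrite D0 /form4 !rmorph0 !mul0r !mulr0 !addr0.
have Dg : 0 < D by rewrite lt_def D0 dot_ge0.
set n := sqrtC D; have nn : n * n = D by rewrite -expr2 sqrtCK.
have n0 : n != 0 by rewrite sqrtC_eq0.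
have nr : n^* = n by rewrite conj_Creal // ger0_real // sqrtC_ge0 ltW.
rewrite scalerDr !scalerA hk.
  by rewrite /form4 !rmorphM fmorphV /= nr -nn; field.
by rewrite !normCK !rmorphM fmorphV /= nr -[RHS](divff D0) {1}DE -nn; field.
Qed.

Lemma hextZ c z : hext (c *: z) = c * c^* * hext z.
Proof.
rewrite /hext dotZr dotZl mulrA.
have [->|c0] := eqVneq c 0; first by rewrite !mul0r.
have [D0|D0] := eqVneq (dot z z) 0; first by rewrite D0 !(mulr0, mul0r).
rewrite -!mulrA; congr (_ * (_ * (_ * _))).
have Dg : 0 < dot z z by rewrite lt_def D0 dot_ge0.
set n := sqrtC (dot z z); have nn : n * n = dot z z by rewrite -expr2 sqrtCK.
have n0 : n != 0 by rewrite sqrtC_eq0.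
have nge : 0 <= n by rewrite sqrtC_ge0 ltW.
have nr : n^* = n by rewrite conj_Creal // ger0_real.
have -> : sqrtC (c * (c^* * dot z z)) = `|c| * n.
  by rewrite mulrA -normCK -nn -expr2 -exprMn sqrCK // mulr_ge0.
have uz : unit (n^-1 *: z).
  by rewrite /unit dotZr dotZl fmorphV /= nr -nn; field.
rewrite scalerA -(admP admW WF _ uz (c := c / `|c|)).
  by rewrite scalerA; congr (F (_ *: _)); field; rewrite n0 normr_eq0 c0.
by rewrite normf_div normr_id divff // normr_eq0.
Qed.

(** Two vectors lie in a common plane, where [hext] is a quadratic form by [hext_plane]. *)
Lemma hext_parallelogram z w : hext (z + w) + hext (z - w) = 2 * hext z + 2 * hext w.
Proof.
have h0 : hext 0 = 0 by rewrite /hext dot0r mul0r.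
have hN v : hext (- v) = hext v.
  by rewrite -scaleN1r hextZ rmorphN rmorph1 mulrNN mulr1 mul1r.
have [->|/ex_unit_dir[n [u [_ _ uu ->]]]] := eqVneq z 0.
  by rewrite add0r sub0r hN h0; ring.
pose b := dot u w; pose w' := w - b *: u.
have wE : w = b *: u + w' by rewrite addrC subrK.
have uw' : dot u w' = 0 by rewrite dotBr dotZr uu mulr1 subrr.
have [w0|/ex_unit_dir[c [v [c0 _ uv vE]]]] := eqVneq w' 0.
  rewrite wE w0 addr0 -scalerDl -scalerBl !hextZ rmorphB rmorphD /=; ring.
have duv : dot u v = 0.
  by move: uw'; rewrite vE dotZr => /eqP; rewrite mulf_eq0 gt_eqF // => /eqP.
have [k hk] := hext_plane uu uv duv.
rewrite wE vE.
have -> : n *: u + (b *: u + c *: v) = (n + b) *: u + c *: v.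
  by rewrite addrA scalerDl.
have -> : n *: u - (b *: u + c *: v) = (n - b) *: u + (- c) *: v.
  by rewrite opprD addrA scalerBl scaleNr.
have -> : n *: u = n *: u + 0 *: v by rewrite scale0r addr0.
rewrite !hk /form4 rmorphB rmorphD rmorphN rmorph0 /=; ring.
Qed.

Definition polar z w := hext (z + w) - hext z - hext w.

Lemma polarC z w : polar z w = polar w z.
Proof. by rewrite /polar [w + z]addrC addrAC. Qed.

(* Jordan and von Neumann's argument. *)
Lemma polarDl z w e : polar (z + w) e = polar z e + polar w e.
Proof.
have two0 : 2 != 0 :> C by rewrite pnatr_eq0.
have p1 := hext_parallelogram (z + e) w.
have p2 := hext_parallelogram (w + e) z.
have p3 := hext_parallelogram e (z - w).
have p4 := hext_parallelogram z w.
have E1 : z + e + w = z + w + e by rewrite addrAC.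
have E2 : w + e + z = z + w + e by rewrite addrAC [w + z]addrC.
have E3 : z + e - w = e + (z - w) by rewrite [z + e]addrC addrA.
have E4 : w + e - z = e - (z - w) by rewrite [w + e]addrC opprB addrA.
rewrite E1 E3 in p1; rewrite E2 E4 in p2.
apply: (mulfI two0); rewrite /polar.
set A := hext (z + w + e) in p1 p2 *; set B := hext (z + e) in p1 *.
set D := hext (w + e) in p2 *; set X := hext (z - w) in p3 p4.
set Y := hext (z + w) in p4 *; set U := hext (e + (z - w)) in p1 p3.
set V := hext (e - (z - w)) in p2 p3.
transitivity ((A + U) + (A + V) - (U + V) - 2 * Y - 2 * hext e); first ring.
rewrite p1 p2 p3; have -> : X = 2 * hext z + 2 * hext w - Y by rewrite -p4; ring.
ring.
Qed.

Lemma polar0l z : polar 0 z = 0.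
Proof. by rewrite /polar add0r /hext dot0r mul0r subr0 subrr. Qed.

Lemma polar_suml (I : finType) (a : I -> 'cV[C]_d) z :
  polar (\sum_i a i) z = \sum_i polar (a i) z.
Proof.
apply: (big_morph (polar^~ z)) => [x y|]; [exact: polarDl | exact: polar0l].
Qed.

Lemma polar_sumr (I : finType) (a : I -> 'cV[C]_d) z :
  polar z (\sum_i a i) = \sum_i polar z (a i).
Proof. by rewrite polarC polar_suml; apply: eq_bigr => i _; rewrite polarC. Qed.

Lemma polar_diag z : polar z z = 2 * hext z.
Proof.
have -> : polar z z = hext (2 *: z) - hext z - hext z by rewrite /polar scaler_nat mulr2n.
rewrite hextZ conjC_nat; ring.
Qed.

Definition bas i : 'cV[C]_d := delta_mx i 0.

Lemma dot_bas i z : dot (bas i) z = z i 0.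
Proof.
rewrite /dot (bigD1 i) //= big1 ?addr0 => [|j ji]; first by rewrite !mxE !eqxx rmorph1 mul1r.
by rewrite !mxE (negPf ji) rmorph0 mul0r.
Qed.

Lemma unit_bas i : unit (bas i). Proof. by rewrite /unit dot_bas mxE !eqxx. Qed.

Lemma dot_bas_neq i j : i != j -> dot (bas i) (bas j) = 0.
Proof. by move=> h; rewrite dot_bas mxE (negPf h). Qed.

Lemma bas_sum z : z = \sum_i z i 0 *: bas i.
Proof.
apply/matrixP => i j; rewrite (ord1 j) summxE (bigD1 i) //= big1 => [|k ki].
  by rewrite !mxE !eqxx mulr1 addr0.
by rewrite !mxE eq_sym (negPf ki) mulr0.
Qed.

(** Additivity of [polar] suffices: after expansion in the standard basis, each term lives on a
    coordinate plane, where its dependence on the coordinates is explicit. *)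
Lemma born_form : exists M : 'M[C]_d, forall z, unit z ->
  F z = \sum_i \sum_j M i j * (z j 0 * (z i 0)^*).
Proof.
have ex (ij : 'I_d * 'I_d) : exists k : C * C, forall z,
    polar (z ij.1 0 *: bas ij.1) (z ij.2 0 *: bas ij.2) =
    k.1 * (z ij.1 0 * (z ij.2 0)^*) + k.2 * ((z ij.1 0)^* * z ij.2 0).
  case: ij => i j /=; have [<-|ij] := eqVneq i j.
    exists (2 * hext (bas i), 0) => z /=; rewrite polar_diag hextZ; ring.
  have [k hk] := hext_plane (unit_bas i) (unit_bas j) (dot_bas_neq ij).
  exists (k.1.2, k.2) => z /=; rewrite /polar hk.
  have -> : hext (z i 0 *: bas i) = form4 k (z i 0) 0 by rewrite -hk scale0r addr0.
  have -> : hext (z j 0 *: bas j) = form4 k 0 (z j 0) by rewrite -hk scale0r add0r.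
  rewrite /form4 !rmorph0; ring.
have [k hk] := choice ex.
(* The monomial [z j 0 * (z i 0)^*] arises from the ordered pairs [(j, i)] and [(i, j)]; the half
   comes from [polar_diag]. *)
exists (\matrix_(i, j) (((k (j, i)).1 + (k (i, j)).2) / 2)) => z uz.
rewrite -hext_unit //; have two0 : 2 != 0 :> C by rewrite pnatr_eq0.
apply: (mulfI two0); rewrite -polar_diag {1 2}[z]bas_sum polar_suml.
under eq_bigr do rewrite polar_sumr.
under eq_bigr do under eq_bigr do rewrite (hk (_, _)) /=.
under eq_bigr do rewrite big_split /=.
rewrite big_split /= exchange_big /= -big_split /= mulr_sumr.
apply: eq_bigr => i _; rewrite -big_split /= mulr_sumr; apply: eq_bigr => j _.
by rewrite !mxE; field.
Qed.

End Extension.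
End BornForm.

(** * The pigeonhole principle for complex vectors *)

Section ComplexNumbers.
Implicit Types (x y : Rdefinitions.R) (z : Cx).

Lemma norm_complex_le x y : `|(x +i* y)%C| <= ((`|x| + `|y|)%:C)%C.
Proof.
rewrite normc_def lecR /= -[X in _ <= X]ger0_norm ?addr_ge0 // -sqrtr_sqr.
rewrite ler_wsqrtr // sqrrD !real_normK ?num_real // lerD2r lerDl.
by rewrite mulrn_wge0 // mulr_ge0.
Qed.

Lemma norm_complex_ge x y : (`|x|%:C)%C <= `|(x +i* y)%C| /\ (`|y|%:C)%C <= `|(x +i* y)%C|.
Proof.
rewrite normc_def !lecR /= -!sqrtr_sqr.
by split; rewrite ler_wsqrtr // ?lerDl ?lerDr sqr_ge0.
Qed.

Lemma conj_complex x y : ((x +i* y)%C : Cx)^* = (x +i* (- y))%C.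
Proof. by []. Qed.

(** Real and imaginary parts are rounded to a grid of step [e / 2]. Boundedness leaves finitely many
    codes, and vectors with equal codes are close. *)
Lemma pigeonhole_complex : pigeonhole Cx.
Proof.
move=> K v M vM eps eps0.
case: M vM => M Mi vM; case: eps eps0 => e ei; rewrite ltcE /= => /andP[/eqP eiE e0].
subst ei.
have reE n k : `|@complex.Re _ (v n k)| <= M /\ `|@complex.Im _ (v n k)| <= M.
  have := vM n k; case: (v n k) => a b /=; have [h1 h2] := norm_complex_ge a b.
  by move=> h; split; [move: (le_trans h1 h) | move: (le_trans h2 h)];
    rewrite lecE /= => /andP[].
pose eta := e / 2; have eta0 : 0 < eta by rewrite divr_gt0.
pose code (x : Rdefinitions.R) := Num.truncn ((x + M) / eta).
have pos x : `|x| <= M -> 0 <= (x + M) / eta.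
  rewrite ler_norml => /andP[h _]; rewrite divr_ge0 ?(ltW eta0) // -lerBlDr sub0r //.
pose B := (Num.truncn (2 * M / eta)).+1.
have codeB x : `|x| <= M -> (code x < B)%N.
  move=> h; rewrite ltnS; apply: le_truncn.
  rewrite ler_pM2r ?invr_gt0 // mulr_natl mulr2n lerD2r.
  by rewrite (le_trans (ler_norm _)).
have codeE x y : `|x| <= M -> `|y| <= M -> code x = code y -> `|x - y| <= eta.
  move=> hx hy E.
  have /andP[x1 x2] := truncn_itv (pos _ hx); have /andP[y1 y2] := truncn_itv (pos _ hy).
  rewrite -/(code x) in x1 x2; rewrite -/(code y) -E in y1 y2.
  rewrite -natr1 ltr_pdivrMr // in x2; rewrite -natr1 ltr_pdivrMr // in y2.
  rewrite ler_pdivlMr // in x1; rewrite ler_pdivlMr // in y1.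
  rewrite ler_norml; apply/andP; split; lra.
pose c (n : nat) : {ffun K -> 'I_B * 'I_B} :=
  [ffun k => (inord (code (@complex.Re _ (v n k))), inord (code (@complex.Im _ (v n k))))].
have [n [m [nm cE]]] : exists n m, (n < m)%N /\ c n = c m.
  have : ~~ injectiveb (fun i : 'I_(#|{ffun K -> 'I_B * 'I_B}|.+1) => c i).
    apply/negP => /injectiveP /leq_card; rewrite card_ord.
    by rewrite ltnn.
  move/injectivePn => [i [j ij cij]].
  have : (i < j)%N || (j < i)%N by rewrite -neq_ltn.
  by case/orP => h; [exists i, j | exists j, i].
exists n, m; split=> // k.
have := congr1 (fun f : {ffun K -> 'I_B * 'I_B} => f k) cE; rewrite !ffunE => -[E1 E2].
have [r1 i1] := reE n k; have [r2 i2] := reE m k.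
move/(congr1 val): E1; rewrite /= !inordK ?codeB // => /codeE -/(_ r1 r2).
move/(congr1 val): E2; rewrite /= !inordK ?codeB // => /codeE -/(_ i1 i2).
case: (v n k) => a b; case: (v m k) => a' b' /= h1 h2.
have -> : (a +i* b)%C - (a' +i* b')%C = ((a - a') +i* (b - b'))%C :> Cx by [].
apply: (le_trans (norm_complex_le _ _)); rewrite lecR.
by apply: (le_trans (lerD h2 h1)); rewrite /eta; lra.
Qed.

End ComplexNumbers.

(** * Real spans of outcome probability functions *)

Section RealSpan.
Variables (d : nat) (S : fn d -> Prop).
Implicit Types (f g : fn d) (v w : uvec d).

Lemma in_span0 : in_span S (fun=> 0).
Proof.
exists 0%N, (fun=> 0), (fun _ => fun=> 0); split; first by case.
by apply/funext => x; rewrite big_ord0.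
Qed.

Lemma in_span_cons c f g : S f -> in_span S g -> in_span S (fun x => c * f x + g x).
Proof.
move=> Sf [n [a [h [Sh ->]]]].
exists n.+1, (fun i => if unlift ord0 i is Some j then a j else c),
  (fun i => if unlift ord0 i is Some j then h j else f); split.
  by move=> i; case: unliftP.
apply/funext => x; rewrite big_ord_recl unlift_none; congr (_ + _).
by apply: eq_bigr => i _; rewrite liftK.
Qed.

Lemma in_span_ind (P : fn d -> Prop) : P (fun=> 0) ->
  (forall c f g, S f -> in_span S g -> P g -> P (fun x => c * f x + g x)) ->
  forall f, in_span S f -> P f.
Proof.
move=> P0 PL f [n [a [h [Sh ->]]]].
suff [//] : P (fun x => \sum_(i < n) a i * h i x) /\
    in_span S (fun x => \sum_(i < n) a i * h i x).
elim: n a h Sh => [|n IH] a h Sh.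
  have -> : (fun x => \sum_(i < 0) a i * h i x) = (fun=> 0).
    by apply/funext => x; rewrite big_ord0.
  by split=> //; exact: in_span0.
have [Pn Sn] := IH (fun i => a (lift ord0 i)) (fun i => h (lift ord0 i)) (fun i => Sh _).
have -> : (fun x => \sum_(i < n.+1) a i * h i x) =
    (fun x => a ord0 * h ord0 x + \sum_(i < n) a (lift ord0 i) * h (lift ord0 i) x).
  by apply/funext => x; rewrite big_ord_recl.
by split; [exact: PL | exact: in_span_cons].
Qed.

Lemma in_span_gen f : S f -> in_span S f.
Proof.
move=> Sf; have := in_span_cons 1 Sf in_span0.
by congr in_span; apply/funext => x; rewrite mul1r addr0.
Qed.

Lemma in_spanL c f g : in_span S f -> in_span S g -> in_span S (fun x => c * f x + g x).
Proof.
move=> Sf Sg; elim/in_span_ind: Sf => [|b h k Sh _ Sk].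
  by move: Sg; congr in_span; apply/funext => x; rewrite mulr0 add0r.
have := in_span_cons (c * b) Sh Sk; congr in_span; apply/funext => x; ring.
Qed.

Lemma in_spanZ c f : in_span S f -> in_span S (fun x => c * f x).
Proof.
move=> Sf; have := in_spanL c Sf in_span0.
by congr in_span; apply/funext => x; rewrite addr0.
Qed.

Lemma in_span_sum (I : finType) (c : I -> Rdefinitions.R) (g : I -> fn d) :
  (forall i, in_span S (g i)) -> in_span S (fun x => \sum_i c i * g i x).
Proof.
move=> Sg; suff H (r : seq I) : in_span S (fun x => \sum_(i <- r) c i * g i x) by exact: H.
elim: r => [|i r IH].
  by have := in_span0; congr in_span; apply/funext => x; rewrite big_nil.
have := in_spanL (c i) (Sg i) IH; congr in_span; apply/funext => x.
by rewrite big_cons.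
Qed.

Hypothesis opf : OPF_set S.

Lemma span_same_ray f v w : in_span S f -> same_ray v w -> f v = f w.
Proof.
case: opf => hopf _ _ _ _ Sf vw; elim/in_span_ind: Sf => [//|c g h Sg _ ->].
by have [hg _] := hopf g Sg; rewrite (hg _ _ vw).
Qed.

Lemma span_bounded f : in_span S f -> exists2 M, 0 <= M & forall v, `|f v| <= M.
Proof.
case: opf => hopf _ _ _ _ Sf; elim/in_span_ind: Sf => [|c g h Sg _ [M M0 hM]].
  by exists 0 => // v; rewrite normr0.
exists (`|c| + M); first by rewrite addr_ge0.
move=> v; have [_ /(_ v) /andP[g0 g1]] := hopf g Sg.
rewrite (le_trans (ler_normD _ _)) // lerD // normrM ler_piMr //.
by rewrite ger0_norm.
Qed.

Lemma span_SU f U : in_span S f -> SU U -> exists2 f', in_span S f' &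
  forall v w, val w = U *m val v -> f' v = f w.
Proof.
move=> Sf hU; case: opf => _ _ hC1 _ _.
elim/in_span_ind: Sf => [|c g h Sg _ [h' Sh' hE]]; first by exists (fun=> 0) => //; exact: in_span0.
have [g' [Sg' gE]] := hC1 g U Sg hU.
exists (fun x => c * g' x + h' x); first exact: in_span_cons.
by move=> v w vw; rewrite (gE v w vw) (hE v w vw).
Qed.

End RealSpan.

(** * Complex reflections as unitary matrices *)

Section Reflection.
Variable d : nat.
Implicit Types (e z : 'cV[Cx]_d) (t c : Cx).

Lemma unitvecE z : unitvec z <-> unit z.
Proof.
have E : \sum_(i < d) `|z i 0| ^+ 2 = dot z z.
  by apply: eq_bigr => i _; rewrite normCK mulrC.
by rewrite /unitvec E; split=> [/eqP|->].
Qed.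

Lemma unit_val (v : uvec d) : unit (val v).
Proof. by apply/unitvecE; exact: (valP v). Qed.

Lemma ex_uvec z : unit z -> exists v : uvec d, val v = z.
Proof. by move=> /unitvecE uz; exists (Sub z uz); rewrite SubK. Qed.

Lemma adj_mul e z : adj e *m z = (dot e z)%:M.
Proof.
apply/matrixP => i j; rewrite (ord1 i) (ord1 j) !mxE eqxx mulr1n.
by apply: eq_bigr => k _; rewrite !mxE.
Qed.

Definition rfl_mx e t : 'M[Cx]_d := 1%:M + (t - 1) *: (e *m adj e).

Lemma rfl_mxE e t z : rfl_mx e t *m z = rfl e t z.
Proof.
rewrite /rfl_mx mulmxDl mul1mx -scalemxAl -mulmxA adj_mul mul_mx_scalar scalerA.
by [].
Qed.

Lemma adj_proj e : adj (e *m adj e) = e *m adj e.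
Proof.
apply/matrixP => i j; rewrite !mxE rmorph_sum; apply: eq_bigr => k _.
by rewrite !mxE rmorphM /= conjCK mulrC.
Qed.

Lemma adjmxZ c (A : 'M[Cx]_d) : adj (c *: A) = c^* *: adj A.
Proof. by apply/matrixP => i j; rewrite !mxE rmorphM. Qed.

Lemma adjmxD (A B : 'M[Cx]_d) : adj (A + B) = adj A + adj B.
Proof. by apply/matrixP => i j; rewrite !mxE rmorphD. Qed.

Lemma adjmx1 : adj (1%:M : 'M[Cx]_d) = 1%:M.
Proof.
by apply/matrixP => i j; rewrite !mxE eq_sym; case: (i == j); rewrite ?rmorph1 ?rmorph0.
Qed.

Lemma rfl_mx_unitary e t : unit e -> `|t| = 1 -> rfl_mx e t *m adj (rfl_mx e t) = 1%:M.
Proof.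
move=> ue /unit_norm1 ht; rewrite /rfl_mx adjmxD adjmx1 adjmxZ adj_proj.
set E := e *m adj e; have EE : E *m E = E.
  by rewrite /E mulmxA -[e *m adj e *m e]mulmxA adj_mul ue mulmx1.
rewrite mulmxDl mul1mx mulmxDr mulmx1 -scalemxAl -scalemxAr EE.
rewrite -addrA scalerA -!scalerDl.
suff -> : (t - 1)^* + ((t - 1) + (t - 1) * (t - 1)^*) = 0 by rewrite scale0r addr0.
rewrite rmorphB /= rmorph1; transitivity (t * t^* - 1); first ring.
by rewrite ht subrr.
Qed.

(** A [d]-th root of the conjugate determinant normalizes the determinant to 1. This phase is
    invisible on rays, so C1 for SU extends to all reflections. *)
Lemma rfl_SU e t : unit e -> `|t| = 1 -> exists2 c, `|c| = 1 & SU (c *: rfl_mx e t).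
Proof.
move=> ue ht; have uU := rfl_mx_unitary ue ht; set U := rfl_mx e t in uU *.
have d0 : (0 < d)%N.
  case: (posnP d) => // d0; move: ue; rewrite /unit /dot big1; last first.
    by move=> [j hj] _; have : (j < 0)%N by rewrite -d0.
  by move/esym/eqP; rewrite oner_eq0.
have detU : \det U * (\det U)^* = 1.
  have := congr1 determinant uU; rewrite det_mulmx det1 => <-; congr (_ * _).
  by rewrite /adj det_tr -det_map_mx.
have nU : `|\det U| = 1.
  by apply/eqP; rewrite -(@eqrXn2 _ 2) // normCK detU expr1n.
pose c := d.-root ((\det U)^*).
have cd : c ^+ d = (\det U)^* by rewrite rootCK.
have nc : `|c| = 1.
  apply/eqP; rewrite -(@pexpr_eq1 _ _ d) //.
  by rewrite -normrX cd norm_conjC nU.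
exists c => //; split.
  by rewrite adjmxZ -scalemxAl -scalemxAr uU scalerA unit_norm1 // scale1r.
by rewrite detZ cd mulrC.
Qed.

End Reflection.

(** While the rank is below [n], some nonzero combination of the functions vanishes at all chosen
    points. Independence gives a point where it does not, and adding that point raises the rank. *)
Lemma lin_indep_points (X : Type) (n : nat) (b : 'I_n -> X -> Rdefinitions.R) :
  (forall c : 'I_n -> Rdefinitions.R, (forall x, \sum_i c i * b i x = 0) -> forall i, c i = 0) ->
  exists (s : seq X) (L : 'M[Rdefinitions.R]_(n, size s)),
    L *m (\matrix_(i < size s, j < n) b j (tnth (in_tuple s) i)) = 1%:M.
Proof.
move=> lib; pose ev s := \matrix_(i < size s, j < n) b j (tnth (in_tuple s) i).
suff [s /eqP/row_fullP[L hL]] : exists s, \rank (ev s) = n by exists s, L.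
suff [s hs] : exists s, (n <= \rank (ev s))%N.
  by exists s; apply/eqP; rewrite eqn_leq rank_leq_col hs.
suff H k : (k <= n)%N -> exists s, (k <= \rank (ev s))%N by exact: H.
elim: k => [|k IH] kn; first by exists [::].
have [s hs] := IH (ltnW kn).
case: (leqP k.+1 (\rank (ev s))) => [h|h]; first by exists s.
have K0 : kermx (ev s)^T != 0.
  rewrite -mxrank_eq0 mxrank_ker mxrank_tr -lt0n subn_gt0.
  exact: leq_trans h kn.
pose c := nz_row (kermx (ev s)^T).
have c0 : c != 0 by rewrite nz_row_eq0.
have cE : c *m (ev s)^T = 0 by apply/sub_kermxP; exact: nz_row_sub.
have [x cx] : exists x, \sum_i c 0 i * b i x != 0.
  apply: contrapT => none; move/negP: c0; apply; apply/eqP/matrixP => i j.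
  rewrite (ord1 i) mxE; apply: (lib (fun i => c 0 i)) => x.
  by apply: contrapT => /eqP hx; apply: none; exists x.
pose v : 'rV_n := \row_j b j x.
have vN : ~~ (v <= ev s)%MS.
  apply: contra cx => /submxP[D vD].
  have : v *m c^T = 0 by rewrite vD -mulmxA -[ev s]trmxK -trmx_mul cE trmx0 mulmx0.
  move/matrixP/(_ 0 0); rewrite !mxE => E; apply/eqP; rewrite -[RHS]E.
  by apply: eq_bigr => i _; rewrite !mxE mulrC.
exists (x :: s).
have sub1 : (v <= ev (x :: s))%MS.
  have -> : v = row ord0 (ev (x :: s)) by apply/rowP => j; rewrite !mxE (tnth_nth x).
  exact: row_sub.
have sub2 : (ev s <= ev (x :: s))%MS.
  apply/row_subP => i; have -> : row i (ev s) = row (lift ord0 i) (ev (x :: s)).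
    by apply/rowP => j; rewrite !mxE !(tnth_nth x).
  exact: row_sub.
apply: (leq_ltn_trans hs); apply: rank_ltmx; rewrite ltmxE sub2 /=.
by apply: contra vN; apply: submx_trans.
Qed.

(** * Complexified spans and product states *)

Section ComplexSpan.
Variables (d : nat) (S : fn d -> Prop).
Implicit Types (f g : fn d) (F : 'cV[Cx]_d -> Cx).

(* Elements of the complexified span, viewed as functions on all of C^d of which
   only the values on unit vectors matter. *)
Definition cspan F := exists f g, [/\ in_span S f, in_span S g &
  forall v : uvec d, F (val v) = (f v +i* g v)%C].

Definition ext f (z : 'cV[Cx]_d) : Cx :=
  if insub z is Some v then ((f v)%:C)%C else 0.

Lemma ext_val f (v : uvec d) : ext f (val v) = ((f v)%:C)%C.
Proof. by rewrite /ext valK. Qed.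

Lemma cspan_ext f : in_span S f -> cspan (ext f).
Proof.
by move=> Sf; exists f, (fun=> 0); split=> // [|v]; [exact: in_span0 | rewrite ext_val].
Qed.

Lemma sum_complex (I : finType) (x y : I -> Rdefinitions.R) :
  \sum_i ((x i +i* y i)%C : Cx) = ((\sum_i x i) +i* (\sum_i y i))%C.
Proof. by elim/big_rec3: _ => // i p q r _ ->. Qed.

Lemma complex_bilin (p q a b a' b' : Rdefinitions.R) :
  ((p +i* q)%C : Cx) * (a +i* b)%C + (a' +i* b')%C =
  ((p * a + ((- q) * b + a')) +i* (p * b + (q * a + b')))%C.
Proof. by apply/eqP; rewrite eq_complex /=; apply/andP; split; apply/eqP; ring. Qed.

Hypothesis opf : OPF_set S.
Variables (I : finType) (b : I -> fn d).
Hypothesis bas_b : basis_of_span S b.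

(** A left inverse of the evaluation matrix recovers the coefficients in [b] from the values at the
    points of [s]. *)
Lemma cspan_dual_basis : exists (s : seq (uvec d)) (g : 'I_(size s) -> fn d),
  (forall i, in_span S (g i)) /\
  forall f, in_span S f -> forall v, f v = \sum_i f (tnth (in_tuple s) i) * g i v.
Proof.
case: bas_b => Sb lib gen; pose bb (j : 'I_#|I|) := b (enum_val j).
have reidx (c : I -> Rdefinitions.R) x :
    \sum_i c i * b i x = \sum_(j < #|I|) c (enum_val j) * bb j x.
  by rewrite (reindex (@enum_val I predT)) //; exact/onW_bij/enum_val_bij.
have [c hc|s [L hL]] := @lin_indep_points (uvec d) #|I| bb.
  have := lib (fun i => c (enum_rank i)); move=> H j.
  rewrite -(enum_valK j); apply: H => x; rewrite reidx -[RHS](hc x).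
  by apply: eq_bigr => k _; rewrite enum_valK.
exists s, (fun i x => \sum_j L j i * bb j x); split.
  by move=> i; apply: in_span_sum => j; exact: Sb.
move=> f Sf v; have [c fE] := gen f Sf.
have fE' x : f x = \sum_(j < #|I|) c (enum_val j) * bb j x by rewrite fE reidx.
pose al : 'cV_#|I| := \col_j c (enum_val j).
have alE : L *m (\col_i f (tnth (in_tuple s) i)) = al.
  rewrite -[RHS]mul1mx -hL -mulmxA; congr (_ *m _).
  apply/matrixP => i j; rewrite !mxE fE'; apply: eq_bigr => k _.
  by rewrite !mxE mulrC.
rewrite fE'; under [RHS]eq_bigr do rewrite mulr_sumr.
rewrite exchange_big /=; apply: eq_bigr => j _.
have -> : c (enum_val j) = al j 0 by rewrite mxE.
rewrite -alE mxE mulr_suml; apply: eq_bigr => i _.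
by rewrite !mxE; ring.
Qed.

Lemma cspan_admissible : admissible cspan.
Proof.
split.
- by exists (fun=> 0), (fun=> 0); split=> //; exact: in_span0.
- move=> [p q] F G [f [g [Sf Sg FE]]] [f' [g' [Sf' Sg' GE]]].
  exists (fun x => p * f x + ((- q) * g x + f' x)), (fun x => p * g x + (q * f x + g' x)).
  by split=> [||v]; [do 2 apply: in_spanL => // .. | rewrite FE GE complex_bilin].
- move=> F G FG [f [g [Sf Sg FE]]]; exists f, g; split=> // v.
  by rewrite -FG //; exact: unit_val.
- move=> e t F ue ht [f [g [Sf Sg FE]]].
  have [c hc hU] := rfl_SU ue ht.
  have [f' Sf' fE] := span_SU opf Sf hU; have [g' Sg' gE] := span_SU opf Sg hU.
  exists f', g'; split=> // v.
  have uz := rfl_unit ue ht (unit_val v).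
  have [w wE] := ex_uvec uz; have [w' w'E] := ex_uvec (unitZ hc uz).
  have E : val w' = (c *: rfl_mx e t) *m val v by rewrite -scalemxAl rfl_mxE w'E.
  have ray : same_ray w w' by exists c; rewrite w'E wE.
  rewrite /= -wE FE (fE _ _ E) (gE _ _ E).
  by rewrite (span_same_ray opf Sf ray) (span_same_ray opf Sg ray).
- move=> c F z [f [g [Sf Sg FE]]] hc uz.
  have [v vE] := ex_uvec uz; have [w wE] := ex_uvec (unitZ hc uz).
  have ray : same_ray v w by exists c; rewrite wE vE.
  by rewrite -wE -vE !FE (span_same_ray opf Sf ray) (span_same_ray opf Sg ray).
- move=> F [f [g [Sf Sg FE]]]; exists f, (fun x => -1 * g x).
  by split=> // [|v]; [exact: in_spanZ | rewrite FE conj_complex mulN1r].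
have [s [g [Sg gE]]] := cspan_dual_basis.
have bnd i : exists M, 0 <= M /\ forall v, `|g i v| <= M.
  by have [M M0 hM] := span_bounded opf (Sg i); exists M.
have [M hM] := choice bnd.
exists (size s), (fun i => val (tnth (in_tuple s) i)), (fun i => ext (g i)),
  (((\sum_i M i)%:C)%C); split.
- by rewrite lecR sumr_ge0 // => i _; case: (hM i).
- by move=> i; exact: unit_val.
- by move=> i; exact: cspan_ext.
- move=> i z uz; have [v <-] := ex_uvec uz; rewrite ext_val.
  apply: (le_trans (norm_complex_le _ _)); rewrite lecR normr0 addr0.
  rewrite (bigD1 i) //=; apply: ler_wpDr; last by case: (hM i).
  by apply: sumr_ge0 => j _; case: (hM j).
move=> F [f [h [Sf Sh FE]]] z uz; have [v <-] := ex_uvec uz.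
rewrite FE (gE f Sf) (gE h Sh) -sum_complex; apply: eq_bigr => i _.
rewrite FE ext_val; apply/eqP; rewrite eq_complex /=.
by apply/andP; split; apply/eqP; ring.
Qed.

End ComplexSpan.

(** Since [F] is real, [M] may be replaced by its Hermitian part. *)
Lemma born_of_form d (F : fn d) (M : 'M[Cx]_d) :
  (forall v : uvec d, ((F v)%:C)%C = \sum_i \sum_j M i j * (val v j 0 * (val v i 0)^*)) ->
  born F.
Proof.
move=> h; have trE (A : 'M[Cx]_d) (v : uvec d) :
    \tr (A *m (val v *m adj (val v))) = \sum_i \sum_j A i j * (val v j 0 * (val v i 0)^*).
  apply: eq_bigr => i _; rewrite mxE; apply: eq_bigr => j _.
  by rewrite !mxE big_ord1 !mxE.
have adjK (A : 'M[Cx]_d) : adj (adj A) = A.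
  by apply/matrixP => i j; rewrite !mxE conjCK.
have half_r : (2^-1 : Cx)^* = 2^-1 by rewrite fmorphV /= conjC_nat.
exists (2^-1 *: (M + adj M)); split.
  by rewrite adjmxZ adjmxD adjK half_r addrC.
move=> v; rewrite -scalemxAl mxtraceZ mulmxDl mxtraceD trE -h.
have -> : \tr (adj M *m (val v *m adj (val v))) = ((F v)%:C)%C.
  have -> : ((F v)%:C)%C = (((F v)%:C)%C : Cx)^* by rewrite conj_complex oppr0.
  rewrite h trE rmorph_sum exchange_big /=; apply: eq_bigr => i _.
  rewrite rmorph_sum; apply: eq_bigr => j _.
  by rewrite !mxE !rmorphM /= conjCK; ring.
by field.
Qed.

Section ProductStates.
Implicit Types (v w : 'cV[Cx]_3).

Definition idx (i j : 'I_3) : 'I_9 := @mxtens_index 3 3 (i, j).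

Definition tens v w : 'cV[Cx]_9 := v *t w.

Lemma tensE v w i j : tens v w (idx i j) 0 = v i 0 * w j 0.
Proof.
have := tensmxE v w i j 0 0; rewrite /tens /idx => <-.
by congr (_ _ _); apply/val_inj.
Qed.

Lemma unit_tens v w : unit v -> unit w -> unit (tens v w).
Proof.
rewrite /unit => hv hw; rewrite /dot.
have bij : {on [pred i | true], bijective (@mxtens_index 3 3)}.
  by apply: onW_bij; exists (@mxtens_unindex 3 3); [exact: mxtens_indexK | exact: mxtens_unindexK].
have -> : \sum_(i < 9) (tens v w i 0)^* * tens v w i 0 =
    \sum_(p : 'I_3 * 'I_3) (tens v w (idx p.1 p.2) 0)^* * tens v w (idx p.1 p.2) 0.
  by rewrite (reindex (@mxtens_index 3 3)) //; apply: eq_bigr => -[i j] _.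
rewrite -(pair_bigA _ (fun i j => (tens v w (idx i j) 0)^* * tens v w (idx i j) 0)) /=.
rewrite -[RHS]mulr1 -{1}hv -hw /dot mulr_suml; apply: eq_bigr => i _.
rewrite mulr_sumr; apply: eq_bigr => j _; rewrite tensE rmorphM /=; ring.
Qed.

Lemma star_product S3 S9 star : product_ok S3 S9 star ->
  forall f g, in_span S3 f -> in_span S3 g ->
  forall (v w : uvec 3) (x : uvec 9), val x = val v *t val w -> star f g x = f v * g w.
Proof.
case=> _ linl linr _ C3 f g Sf Sg v w x xE.
(* Linearity is given for [a * f + g] only; [a = -1] and zero functions yield that [star] vanishes
   at 0. *)
have z0 (h : fn 3) : (fun y => -1 * (fun=> 0 : Rdefinitions.R) y + (fun=> 0) y) = (fun=> 0) :> fn 3.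
  by apply/funext => y; rewrite mulr0 addr0.
have S0 := in_span0 S3.
elim/in_span_ind: Sf => [|c f' h Sf' Sh IH].
  have := linl (-1) _ _ _ S0 S0 Sg; rewrite z0 // => /(congr1 (fun k : fn 9 => k x)) /=.
  by rewrite mulN1r addNr mul0r.
rewrite linl //; last exact: in_span_gen.
rewrite IH mulrDl -mulrA; congr (_ * _ + _).
elim/in_span_ind: Sg {IH} => [|e g' k Sg' Sk IH].
  have := linr (-1) _ _ _ S0 S0 (in_span_gen Sf').
  rewrite z0 // => /(congr1 (fun k : fn 9 => k x)) /=.
  by rewrite mulN1r addNr mulr0.
rewrite linr //; try exact: in_span_gen.
by rewrite IH (C3 _ _ Sf' Sg' _ _ _ xE); ring.
Qed.

(* This is what local tomography says about functions. *)
Lemma span_product_eq0 S3 S9 star (I : finType) (b : I -> fn 3) :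
  product_ok S3 S9 star -> basis_of_span S3 b ->
  basis_of_span S9 (fun p : I * I => star (b p.1) (b p.2)) ->
  forall f, in_span S9 f ->
  (forall (v w : uvec 3) (x : uvec 9), val x = val v *t val w -> f x = 0) ->
  forall x, f x = 0.
Proof.
move=> hs [Sb lib _] [_ _ gen] f Sf f0 x.
have [c fE] := gen f Sf.
(* On product vectors the expansion is a bilinear combination of [b k v * b l w]; independence is
   applied in each factor in turn. *)
have c0 i j : c (i, j) = 0.
  apply: (lib (fun j => c (i, j))) => w.
  apply: (lib (fun i => \sum_j c (i, j) * b j w)) => v.
  have [y yE] := ex_uvec (unit_tens (unit_val v) (unit_val w)).
  have := f0 v w y yE; rewrite fE => E; rewrite -[RHS]E.
  transitivity (\sum_k \sum_l c (k, l) * star (b k) (b l) y); last first.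
    by rewrite pair_bigA /=; apply: eq_bigr => -[].
  apply: eq_bigr => k _; rewrite mulr_suml; apply: eq_bigr => l _.
  by rewrite (star_product hs (Sb k) (Sb l) yE); ring.
by rewrite fE big1 // => -[i j] _; rewrite c0 mul0r.
Qed.

End ProductStates.

Lemma complex_eq0 (x y : Rdefinitions.R) : (x +i* y)%C = 0 :> Cx -> x = 0 /\ y = 0.
Proof. by case. Qed.

(** * Failure of local tomography *)

Lemma minor_neq0 (C : numClosedFieldType) d J (k1 k2 k3 k4 k5 : 'I_d) :
  uniq [:: k1; k2; k3; k4; k5] ->
  exists2 z : 'cV[C]_d, unit z &
    dot (bas C k1) z ^+ (J - 2) * (dot (bas C k1) z * dot (bas C k2) z -
      dot (bas C k4) z * dot (bas C k5) z) * (dot (bas C k3) z)^* ^+ J != 0.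
Proof.
rewrite /= !inE !negb_or -!andbA => /and5P[h12 h13 h14 h15 /and5P[h23 h24 h25 h34 _]].
(* A rational unit vector, as [1 + 4 + 4 = 9], with zero coordinate at [k4], so that the minor
   reduces to its first product. *)
have [z z_def] : exists z,
    z = (1 / 3) *: bas C k1 + (2 / 3) *: bas C k2 + (2 / 3) *: bas C k3 by eexists.
have zE i : dot (bas C i) z = 1 / 3 * (i == k1)%:R + 2 / 3 * (i == k2)%:R + 2 / 3 * (i == k3)%:R.
  by rewrite z_def dot_bas !mxE eqxx !andbT.
have z1 : dot (bas C k1) z = 1 / 3.
  by rewrite zE eqxx (negPf h12) (negPf h13) !mulr0 !addr0 mulr1.
have z2 : dot (bas C k2) z = 2 / 3.
  by rewrite zE eqxx (negPf h23) eq_sym (negPf h12) !mulr0 addr0 add0r mulr1.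
have z3 : dot (bas C k3) z = 2 / 3.
  by rewrite zE eqxx ![k3 == _]eq_sym (negPf h13) (negPf h23) !mulr0 !add0r mulr1.
have z4 : dot (bas C k4) z = 0.
  by rewrite zE ![k4 == _]eq_sym (negPf h14) (negPf h24) (negPf h34) !mulr0 !addr0.
have cr (n : nat) : (n%:R / 3 : C)^* = n%:R / 3 by rewrite rmorphM fmorphV /= !conjC_nat.
have cr1 : (1 / 3 : C)^* = 1 / 3 by exact: (cr 1%N).
have cr2 : (2 / 3 : C)^* = 2 / 3 by exact: cr.
exists z.
  rewrite /unit {1}z_def !dotDl !dotZl z1 z2 z3 cr1 cr2; by field.
rewrite z1 z2 z3 z4 cr2 mul0r subr0.
by rewrite !mulf_neq0 ?expf_neq0 ?mulf_neq0 ?invr_eq0 ?oner_eq0 ?pnatr_eq0.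
Qed.

Theorem mainTheorem2 (S3 : fn 3 -> Prop) (S9 : fn 9 -> Prop)
    (star : fn 3 -> fn 3 -> fn 9) :
  OPF_set S3 -> OPF_set S9 -> alternative S3 -> alternative S9 ->
  product_ok S3 S9 star ->
  forall (I : finType) (b : I -> fn 3), basis_of_span S3 b ->
    ~ basis_of_span S9 (fun p : I * I => star (b p.1) (b p.2)).
Proof.
move=> _ opf9 _ [F [SF nbF]] hs I b b3 b9.
(* The finite basis assumed for contradiction supplies the reproducing formula [admF]. *)
have admW := cspan_admissible opf9 b9.
have [[J [J1 dJ [u [f [z [uu Wf uz fz wf]]]]]]|d1] :=
  extremal_dichotomy pigeonhole_complex admW; last first.
  apply: nbF; have [M hM] := born_form admW d1 (cspan_ext (in_span_gen SF)).
  by apply: (born_of_form (M := M)) => v; rewrite -ext_val hM //; exact: unit_val.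
pose i0 : 'I_3 := ord0; pose i1 : 'I_3 := Ordinal (isT : 1 < 3)%N; pose i2 : 'I_3 := ord_max.
pose e i j := bas Cx (idx i j).
have ne i j k l : idx i j != idx k l -> dot (e i j) (e k l) = 0 by exact: dot_bas_neq.
have [al [be [Sal Sbe hE]]] := minor_function admW J1 (unit_bas _ (idx i2 i2))
  (fun p up pq => extremal_pair admW (ltnW J1) dJ uu Wf uz fz wf up (unit_bas _ (idx i2 i2)) pq)
  (ne i0 i0 i2 i2 isT) (ne i1 i1 i2 i2 isT) (ne i0 i1 i2 i2 isT) (ne i1 i0 i2 i2 isT).
(* [al] and [be] are the real and imaginary parts of the minor function; on [v *t w] both products
   of the minor equal [v0 * v1 * w0 * w1]. *)
have prod0 (v w : uvec 3) (x : uvec 9) : val x = val v *t val w -> al x = 0 /\ be x = 0.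
  move=> xE; apply: complex_eq0; rewrite -hE !dot_bas.
  have -> : val x = tens (val v) (val w) by exact: xE.
  rewrite !tensE; ring.
have al0 := span_product_eq0 hs b3 b9 Sal (fun v w x E => (prod0 v w x E).1).
have be0 := span_product_eq0 hs b3 b9 Sbe (fun v w x E => (prod0 v w x E).2).
have [|y uy] := @minor_neq0 Cx 9 J (idx i0 i0) (idx i1 i1) (idx i2 i2) (idx i0 i1) (idx i1 i0).
  by [].
by have [x <-] := ex_uvec uy; rewrite hE al0 be0 eqxx.
Qed.
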